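(* Let $n\ge m$, let $A$ be an $n\times n$ matrix and $B$ an $n\times m$ matrix with entries in $\mathfrak K[\delta,\frac{d}{dt}]$, and consider the linear time-delay system $Ax=Bu$ with pseudo-state $x=(x_1,\dots,x_n)^T$ and input $u=(u_1,\dots,u_m)^T$. Let $M$ and $N$ be unimodular matrices over $\mathfrak K(\delta)[\frac{d}{dt}]$, of sizes $n$ and $m$, such that $MBN=\begin{pmatrix}\Delta_B\\0_{n-m,m}\end{pmatrix}$ is a Smith-Jacobson decomposition of $B$, and put $F=(0_{n-m,m},I_{n-m})MA$. A necessary and sufficient condition for the system $Ax=Bu$ to be $\pi$-flat (that is, differentially $\pi$-flat for some polynomial $\pi\in\mathfrak K[\delta]$) is that the matrices $B$ and $F$ are $\mathfrak K(\delta)[\frac{d}{dt}]$-hyper-regular. Moreover, if $B$ and $F$ are hyper-regular, operators $P,Q,R$ and a polynomial $\pi$ are constructed as follows. 0. Take $M$ and $N$ with $MBN=\begin{pmatrix} I_m\\0_{n-m,m}\end{pmatrix}$, set $F=(0_{n-m,m},I_{n-m})MA$, and take unimodular matrices $U$ (size $n-m$) and $\widetilde Q$ (size $n$) over $\mathfrak K(\delta)[\frac{d}{dt}]$ such that $UF\widetilde Q=(I_{n-m},0_{n-m,m})$. There exist $\pi_{M,N},\pi_{U,\widetilde Q}\in\mathfrak K[\delta]$ such that $\pi_{M,N}\cdot M$, $\pi_{M,N}\cdot N$, $\pi_{U,\widetilde Q}\cdot U$ and $\pi_{U,\widetilde Q}\cdot\widetilde Q$ have entries in $\mathfrak K[\delta,\frac{d}{dt}]$;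 let $\bar\pi=\mathrm{LCM}(\pi_{M,N},\pi_{U,\widetilde Q})$. 1. Set $Q=\widetilde Q\begin{pmatrix}0_{n-m,m}\\ I_m\end{pmatrix}$; then $\bar\pi\cdot Q\in\mathcal M_{n,m}[\delta,\frac{d}{dt}]$. 2. Set $R=N(I_m,0_{m,n-m})MAQ$; there exists $\pi_R\in\mathfrak K[\delta]$ such that $\pi_R\cdot R\in\mathcal M_{m,m}[\delta,\frac{d}{dt}]$. 3. Take unimodular matrices $\widetilde P$ (size $n$) and $W$ (size $m$) over $\mathfrak K(\delta)[\frac{d}{dt}]$ such that $\widetilde PQW=\begin{pmatrix} I_m\\0_{n-m,m}\end{pmatrix}$ and set $P=W(I_m,0_{m,n-m})\widetilde P$; there exists $\pi_P\in\mathfrak K[\delta]$ such that $\pi_P\cdot P\in\mathcal M_{m,n}[\delta,\frac{d}{dt}]$. Let $\pi=\mathrm{LCM}(\bar\pi,\pi_P,\pi_R)$. Then $P$, $Q$ and $R$ are defining operators with $y=Px$, $x=Qy$, $u=Ry$, and $y$ is a $\pi$-flat output.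
   Context: Rings. $\mathfrak K$ is the differential field of meromorphic functions of $t$ on the real line. $\delta$ is the delay operator $(\delta f)(t)=f(t-\tau)$ with $\tau>0$ fixed, and $\frac{d}{dt}$ is the time derivative. $\mathfrak K[\delta,\frac{d}{dt}]$ is the skew polynomial ring of finite sums $\sum_{k,l}\alpha_{k,l}(t)\frac{d^k}{dt^k}\delta^l$, $\alpha_{k,l}\in\mathfrak K$, with the rules $\frac{d}{dt}\alpha=\alpha\frac{d}{dt}+\dot\alpha$, $\delta\,\alpha(t)=\alpha(t-\tau)\,\delta$, $\frac{d}{dt}\delta=\delta\frac{d}{dt}$ for $\alpha\in\mathfrak K$. $\mathfrak K(\delta)$ is the (skew) fraction field of $\mathfrak K[\delta]$, and $\mathfrak K(\delta)[\frac{d}{dt}]\supset\mathfrak K[\delta,\frac{d}{dt}]$ is the ring of polynomials in $\frac{d}{dt}$ over $\mathfrak K(\delta)$; it is a principal ideal domain. $\mathcal M_{p,q}[\delta,\frac{d}{dt}]$ denotes the $p\times q$ matrices over $\mathfrak K[\delta,\frac{d}{dt}]$. For nonzero $\pi\in\mathfrak K[\delta]$, $\mathcal M_{p,q}[\delta,\pi^{-1},\frac{d}{dt}]$ denotes the $p\times q$ matrices $S$ (over $\mathfrak K(\delta)[\frac{d}{dt}]$) over the ring $\mathfrak K[\delta,\pi^{-1},\frac{d}{dt}]$, i.e. such that $\pi^s\cdot S\in\mathcal M_{p,q}[\delta,\frac{d}{dt}]$ for some finite $s\in\mathbb N$. $\mathrm{LCM}$ of polynomials in $\mathfrak K[\delta]$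 is their least common (left) multiple. A square matrix over a ring is unimodular if it has a two-sided inverse with entries in that ring. Smith-Jacobson decomposition. For every $p\times q$ matrix $S$ over $\mathfrak K(\delta)[\frac{d}{dt}]$ there exist unimodular $U,V$ over $\mathfrak K(\delta)[\frac{d}{dt}]$ (sizes $p$, $q$) with $USV=(\Delta_p\,|\,0_{p,q-p})$ if $p\le q$, and $USV=\begin{pmatrix}\Delta_q\\0_{p-q,q}\end{pmatrix}$ if $p>q$, where $\Delta_\sigma$ is a $\sigma\times\sigma$ diagonal matrix with diagonal $(d_1,\dots,d_s,0,\dots,0)$, each $d_i$ ($1\le i\le s$) nonzero and dividing $d_j$ for $i\le j\le s$. $S$ is called $\mathfrak K(\delta)[\frac{d}{dt}]$-hyper-regular if it admits such a decomposition with $\Delta_p=I_p$ (if $p\le q$), resp. $\Delta_q=I_q$ (if $p>q$). $\pi$-flatness. The system $Ax=Bu$ is differentially $\pi$-flat if there exist a polynomial $\pi\in\mathfrak K[\delta]$ and a collection $y$ of $m$ $(\delta,\pi^{-1})$-differentially independent variables (i.e. there is no nonzero $S\in\mathcal M_{m,m}[\delta,\pi^{-1},\frac{d}{dt}]$ with $Sy=0$), called a $\pi$-flat output, of the form $y=P_0(\delta,\pi^{-1})x+P_1(\delta,\pi^{-1},\frac{d}{dt})u$ with $P_0$ an $m\times n$ matrix over $\mathfrak K[\delta,\pi^{-1}]$ and $P_1\in\mathcal M_{m,m}[\delta,\pi^{-1},\frac{d}{dt}]$, and such that $x=Q(\delta,\pi^{-1},\frac{d}{dt})y$ and $u=R(\delta,\pi^{-1},\frac{d}{dt})y$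 with $Q\in\mathcal M_{n,m}[\delta,\pi^{-1},\frac{d}{dt}]$, $R\in\mathcal M_{m,m}[\delta,\pi^{-1},\frac{d}{dt}]$. Equivalently, the system module $\Lambda=[\xi,\nu]/[A\xi-B\nu]$ (the quotient of the free $\mathfrak K[\delta,\frac{d}{dt}]$-module on $\xi_1,\dots,\xi_n,\nu_1,\dots,\nu_m$ by the submodule generated by the components of $A\xi-B\nu$) becomes free after localization at the powers of $\pi$, i.e. $\mathfrak K[\delta,\pi^{-1},\frac{d}{dt}]\otimes_{\mathfrak K[\delta,\frac{d}{dt}]}\Lambda$ is free, with $y$ a basis. When $B$ is hyper-regular, $u$ can be eliminated (with $M,N$ such that $MBN=\begin{pmatrix} I_m\\0_{n-m,m}\end{pmatrix}$, the system is $Fx=0$ together with $u=N(I_m,0_{m,n-m})MAx$), and the definition is adapted as follows: the implicit system $Fx=0$ is differentially $\pi$-flat if there exist $\pi\in\mathfrak K[\delta]$ and $m$ $(\delta,\pi^{-1})$-differentially independent variables $y$ (a $\pi$-flat output) with $y=Px$, $P\in\mathcal M_{m,n}[\delta,\pi^{-1},\frac{d}{dt}]$, and $x=Qy$, $Q\in\mathcal M_{n,m}[\delta,\pi^{-1},\frac{d}{dt}]$. The matrices $P,Q$ (and $R$, giving $u=Ry$) are called defining operators of the $\pi$-flat output $y$.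
   Formalization: π-flat is read as y=Px (P may contain d/dt, no u), x=Qy, u=Ry, for every B. With y=P0x+P1u or freeness the claim fails: x=du/dt has flat output y=u, but B=d/dt is not hyper-regular; for freeness only hyper-regularity of F is shown necessary. *)

(* Defs.v *)
From Corelib Require Import ssreflect.
From Stdlib Require Import Reals Lra Lia Classical ClassicalEpsilon Arith.
From Coquelicot Require Import Coquelicot.

Section Meromorphic.
Local Open Scope R_scope.

Definition analytic_at (f : R -> R) (t0 : R) : Prop :=
  exists a : nat -> R, Rbar_lt 0 (CV_radius a) /\
    locally t0 (fun t => f t = PSeries a (t - t0)).

(* [locally' t0] is the filter of punctured neighbourhoods of t0; values of f
   at isolated points are irrelevant, so poles need no special value *)
Definition meromorphic_at (f : R -> R) (t0 : R) : Prop :=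
  exists g h : R -> R, analytic_at g t0 /\ analytic_at h t0 /\
    locally' t0 (fun t => h t <> 0 /\ f t = g t / h t).

Definition meromorphic (f : R -> R) : Prop := forall t0, meromorphic_at f t0.

Definition negligible (f : R -> R) : Prop :=
  forall t0, locally' t0 (fun t => f t = 0).

Definition shift_fun (tau : R) (f : R -> R) : R -> R := fun t => f (t - tau).

Lemma locally'_of (t0 : R) (P : R -> Prop) : locally t0 P -> locally' t0 P.
Proof. intros [e He]; exists e; intros y Hy _; now apply He. Qed.

Lemma ball_RE (x y : R) (e : posreal) : ball x e y <-> Rabs (y - x) < e.
Proof. reflexivity. Qed.

Lemma locally'P (t0 : R) (P : R -> Prop) : locally' t0 P <->
  exists e : posreal, forall t, Rabs (t - t0) < e -> t <> t0 -> P t.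
Proof. reflexivity. Qed.

Lemma locallyP (t0 : R) (P : R -> Prop) : locally t0 P <->
  exists e : posreal, forall t, Rabs (t - t0) < e -> P t.
Proof. reflexivity. Qed.

Lemma locally'_open (t0 : R) (P : R -> Prop) :
  locally' t0 P -> locally' t0 (fun t => locally t P).
Proof.
move=> /locally'P [e He]; apply/locally'P; exists e => t Ht Nt; apply/locallyP.
have H1 : 0 < e - Rabs (t - t0) by lra.
have H2 : 0 < Rabs (t - t0) by apply: Rabs_pos_lt; lra.
have Hm : 0 < Rmin (e - Rabs (t - t0)) (Rabs (t - t0)) by apply: Rmin_pos.
exists (mkposreal _ Hm) => s /= Hs.
have Ha := Rmin_l (e - Rabs (t - t0)) (Rabs (t - t0)).
have Hb := Rmin_r (e - Rabs (t - t0)) (Rabs (t - t0)).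
apply: He.
- have := Rabs_triang (s - t) (t - t0).
  replace (s - t + (t - t0)) with (s - t0) by ring. lra.
- move=> E; subst s; rewrite (Rabs_minus_sym t0 t) in Hs; lra.
Qed.

Lemma radius_loc (a : nat -> R) (t0 : R) : Rbar_lt 0 (CV_radius a) ->
  locally t0 (fun t => Rbar_lt (Rabs (t - t0)) (CV_radius a)).
Proof.
case E: (CV_radius a) => [r | | ] //= H; apply/locallyP.
- by exists (mkposreal r H).
- by exists (mkposreal 1 Rlt_0_1).
Qed.

Lemma radius_pos (a : nat -> R) (r : posreal) :
  (forall x, Rabs x < r -> ex_pseries a x) -> Rbar_lt 0 (CV_radius a).
Proof.
move=> H; have Hr := cond_pos r.
have Hx : Rabs (r / 2) = r / 2 by apply: Rabs_pos_eq; lra.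
apply: (Rbar_lt_le_trans _ (r / 2)); first by simpl; lra.
apply: Rbar_not_lt_le => H1; rewrite -Hx in H1.
apply: (CV_disk_outside _ _ H1); apply: ex_series_lim_0.
have [l Hl] : ex_pseries a (r / 2) by apply: H; rewrite Hx; lra.
by exists l; apply/is_pseries_R.
Qed.

Lemma analytic_const c t0 : analytic_at (fun _ => c) t0.
Proof.
pose a n := match n with 0%nat => c | S _ => 0 end.
have Ha : CV_radius a = p_infty.
  rewrite -CV_radius_derive -CV_radius_const_0; apply: CV_radius_ext => n.
  by rewrite /PS_derive /= Rmult_0_r.
exists a; split; first by rewrite Ha.
apply/locallyP; exists (mkposreal 1 Rlt_0_1) => t _.
rewrite PSeries_decr_1; last by apply: CV_radius_inside; rewrite Ha.
rewrite (PSeries_ext _ (fun _ => 0)); last by case.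
by rewrite PSeries_const_0 /=; ring.
Qed.

Lemma analytic_plus f g t0 : analytic_at f t0 -> analytic_at g t0 ->
  analytic_at (fun t => f t + g t) t0.
Proof.
move=> [a [Ha Hf]] [b [Hb Hg]]; exists (PS_plus a b); split.
  apply: Rbar_lt_le_trans (CV_radius_plus a b).
  exact: (Rbar_min_case _ _ (fun x => Rbar_lt 0 x)).
have Ra := radius_loc a t0 Ha; have Rb := radius_loc b t0 Hb.
generalize (filter_and _ _ (filter_and _ _ Hf Hg) (filter_and _ _ Ra Rb)).
apply: filter_imp => t [[-> ->] [Ia Ib]].
by rewrite PSeries_plus //; apply: CV_radius_inside.
Qed.

Lemma analytic_mult f g t0 : analytic_at f t0 -> analytic_at g t0 ->
  analytic_at (fun t => f t * g t) t0.
Proof.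
move=> [a [Ha Hf]] [b [Hb Hg]]; exists (PS_mult a b).
have Ra := radius_loc a t0 Ha; have Rb := radius_loc b t0 Hb.
split; last first.
  generalize (filter_and _ _ (filter_and _ _ Hf Hg) (filter_and _ _ Ra Rb)).
  by apply: filter_imp => t [[-> ->] [Ia Ib]]; rewrite PSeries_mult.
have [e He] := proj1 (locallyP _ _) (filter_and _ _ Ra Rb).
apply: (radius_pos _ e) => x Hx.
have [] := He (t0 + x); first by replace (t0 + x - t0) with x by ring.
replace (t0 + x - t0) with x by ring.
exact: ex_pseries_mult.
Qed.

Lemma analytic_shift f tau t0 :
  analytic_at f (t0 - tau) -> analytic_at (shift_fun tau f) t0.
Proof.
move=> [a [Ha /locallyP [e He]]]; exists a; split=> //.
apply/locallyP; exists e => t Ht; rewrite /shift_fun He.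
  by f_equal; ring.
by replace (t - tau - (t0 - tau)) with (t - t0) by ring.
Qed.

Lemma analytic_derive f t0 : analytic_at f t0 ->
  analytic_at (Derive f) t0 /\ locally t0 (fun t => ex_derive f t).
Proof.
move=> [a [Ha Hf]]; have Ra := radius_loc a t0 Ha.
have H : locally t0 (fun t => is_derive f t (PSeries (PS_derive a) (t - t0))).
  generalize (filter_and _ _ (locally_locally _ _ Hf) Ra).
  apply: filter_imp => t [Ht It].
  apply: (is_derive_ext_loc (fun s => PSeries a (s - t0))).
    by apply: filter_imp Ht => s ->.
  have -> : PSeries (PS_derive a) (t - t0) =
     scal 1 (PSeries (PS_derive a) (t - t0)) by rewrite /scal /= /mult /=; ring.
  apply: (is_derive_comp (PSeries a) (fun s => s - t0)).
    exact: is_derive_PSeries.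
  by auto_derive.
split.
  exists (PS_derive a); split; first by rewrite CV_radius_derive.
  by apply: filter_imp H => t /is_derive_unique.
by apply: filter_imp H => t Ht; eexists; exact: Ht.
Qed.

Lemma analytic_zero f t0 : analytic_at f t0 ->
  locally' t0 (fun t => f t = 0) \/ locally' t0 (fun t => f t <> 0).
Proof.
move=> [a [Ha Hf]].
case: (classic (exists n, a n <> 0)) => [Hn | Hn]; last first.
  left; apply: locally'_of; apply: filter_imp Hf => t ->.
  rewrite (PSeries_ext _ (fun _ => 0)) ?PSeries_const_0 // => n.
  by apply: NNPP => H; apply: Hn; exists n.
right.
have [n [An Hm]] : exists n, a n <> 0 /\ forall k, (k < n)%nat -> a k = 0.
  have [n [[Pn Ln] _]] :=
    dec_inh_nat_subset_has_unique_least_element (fun n => a n <> 0)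
      (fun n => classic _) Hn.
  exists n; split=> // k Hk; apply: NNPP => /Ln; lia.
pose b := PS_decr_n a n.
have Hb : Rbar_lt 0 (CV_radius b).
  have -> // : CV_radius b = CV_radius a.
  rewrite {}/b {Hm An Hn Hf Ha}; elim: n => [|n IH]; first exact: CV_radius_ext.
  rewrite -IH -(CV_radius_decr_1 (PS_decr_n a n)); apply: CV_radius_ext => k.
  by rewrite /PS_decr_1 /PS_decr_n; f_equal; lia.
have Cb : continuity_pt (PSeries b) 0.
  by apply: PSeries_continuity; rewrite Rabs_R0.
have b0 : PSeries b 0 <> 0 by rewrite PSeries_0 /b /PS_decr_n Nat.add_0_r.
have Hloc : locally 0 (fun x => PSeries b x <> 0).
  have He : 0 < Rabs (PSeries b 0) by apply: Rabs_pos_lt.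
  generalize (proj1 (continuity_pt_locally _ _) Cb (mkposreal _ He)).
  apply: filter_imp => x /= Hx E; rewrite E in Hx.
  by rewrite Rminus_0_l Rabs_Ropp in Hx; lra.
have [e He] := proj1 (locallyP _ _) Hloc.
have [e' He'] := proj1 (locallyP _ _) Hf.
apply/locally'P; exists (mkposreal _ (Rmin_pos _ _ (cond_pos e) (cond_pos e'))).
move=> t /= Ht Nt.
have Hl := Rmin_l e e'; have Hr := Rmin_r e e'.
rewrite He'; last lra.
rewrite (PSeries_decr_n_aux a n) //.
apply: Rmult_integral_contrapositive_currified.
  by apply: pow_nonzero; lra.
by apply: He; rewrite Rminus_0_r; lra.
Qed.

Lemma mero_const c : meromorphic (fun _ => c).
Proof.
move=> t0; exists (fun _ => c), (fun _ => 1); split; [|split].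
- exact: analytic_const.
- exact: analytic_const.
- by apply/locally'P; exists (mkposreal 1 Rlt_0_1) => t _ _; split; [lra|field].
Qed.

Lemma mero_plus f g : meromorphic f -> meromorphic g ->
  meromorphic (fun t => f t + g t).
Proof.
move=> Hf Hg t0; move: (Hf t0) (Hg t0).
move=> [p [q [Hp [Hq H]]]] [r [s [Hr [Hs H']]]].
exists (fun t => p t * s t + r t * q t), (fun t => q t * s t).
split; [|split].
- by apply: analytic_plus; apply: analytic_mult.
- exact: analytic_mult.
- generalize (filter_and _ _ H H'); apply: filter_imp => t [[Nq ->] [Ns ->]].
  by split; [exact: Rmult_integral_contrapositive_currified | field].
Qed.

Lemma mero_mult f g : meromorphic f -> meromorphic g ->
  meromorphic (fun t => f t * g t).
Proof.
move=> Hf Hg t0; move: (Hf t0) (Hg t0).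
move=> [p [q [Hp [Hq H]]]] [r [s [Hr [Hs H']]]].
exists (fun t => p t * r t), (fun t => q t * s t).
split; [|split]; try exact: analytic_mult.
generalize (filter_and _ _ H H'); apply: filter_imp => t [[Nq ->] [Ns ->]].
by split; [exact: Rmult_integral_contrapositive_currified | field].
Qed.

Lemma mero_shift tau f : meromorphic f -> meromorphic (shift_fun tau f).
Proof.
move=> Hf t0; have [p [q [Hp [Hq /locally'P [e He]]]]] := Hf (t0 - tau).
exists (shift_fun tau p), (shift_fun tau q).
split; [|split]; try exact: analytic_shift.
apply/locally'P; exists e => t Ht Nt; apply: He; last lra.
by replace (t - tau - (t0 - tau)) with (t - t0) by ring.
Qed.

Lemma mero_ex_derive f : meromorphic f ->
  forall t0, locally' t0 (fun t => ex_derive f t).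
Proof.
move=> Hf t0; have [p [q [Hp [Hq H]]]] := Hf t0.
have [_ Dp] := analytic_derive _ _ Hp; have [_ Dq] := analytic_derive _ _ Hq.
generalize (filter_and _ _ (locally'_open _ _ H)
  (filter_and _ _ (locally'_of _ _ Dp) (locally'_of _ _ Dq))).
apply: filter_imp => t [Ht [Et Eq]].
apply: (ex_derive_ext_loc (fun s => p s / q s)).
  by apply: filter_imp Ht => s [_ ->].
by apply: ex_derive_div => //; exact: (proj1 (locally_singleton _ _ Ht)).
Qed.

Lemma mero_derive f : meromorphic f -> meromorphic (Derive f).
Proof.
move=> Hf t0; have [p [q [Hp [Hq H]]]] := Hf t0.
have [Ap Dp] := analytic_derive _ _ Hp; have [Aq Dq] := analytic_derive _ _ Hq.
exists (fun t => Derive p t * q t + (fun s => (-1) * (p s * Derive q s)) t),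
  (fun t => q t * q t).
split; [|split].
- apply: analytic_plus; first exact: analytic_mult.
  apply: (analytic_mult (fun _ => -1)); first exact: analytic_const.
  exact: analytic_mult.
- exact: analytic_mult.
generalize (filter_and _ _ (locally'_open _ _ H)
  (filter_and _ _ (locally'_of _ _ Dp) (locally'_of _ _ Dq))).
apply: filter_imp => t [Ht [Et Eq]].
have Nq := proj1 (locally_singleton _ _ Ht).
split; first exact: Rmult_integral_contrapositive_currified.
rewrite (Derive_ext_loc _ (fun s => p s / q s)); last first.
  by apply: filter_imp Ht => s [_ ->].
by rewrite Derive_div //; field.
Qed.

Lemma mero_dichotomy f : meromorphic f -> forall t0,
  locally' t0 (fun t => f t = 0) \/ locally' t0 (fun t => f t <> 0).
Proof.
move=> Hf t0; have [p [q [Hp [Hq H]]]] := Hf t0.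
case: (analytic_zero _ _ Hp) => Z; [left|right];
  generalize (filter_and _ _ H Z); apply: filter_imp => t [[Nq ->] Zt].
- by rewrite Zt; field.
- by apply: Rmult_integral_contrapositive_currified => //; exact: Rinv_neq_0_compat.
Qed.

Lemma mero_inv f : meromorphic f ->
  (forall t0, locally' t0 (fun t => f t <> 0)) -> meromorphic (fun t => / f t).
Proof.
move=> Hf Nf t0; have [p [q [Hp [Hq H]]]] := Hf t0.
exists q, p; split=> //; split=> //.
generalize (filter_and _ _ H (Nf t0)); apply: filter_imp => t [[Nq E] Ft].
have Np : p t <> 0 by move=> Z; apply: Ft; rewrite E Z; field.
by split=> //; rewrite E; field.
Qed.

Lemma locally'_proper (t0 : R) : ~ locally' t0 (fun _ => False).
Proof.
move=> /locally'P [e He]; have H := cond_pos e.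
by apply: (He (t0 + e / 2)); [rewrite Rabs_pos_eq | ]; lra.
Qed.

Lemma mero_null_or f : meromorphic f -> negligible f \/
  forall t0, locally' t0 (fun t => f t <> 0).
Proof.
move=> Hf; pose Z t := locally' t (fun s => f s = 0).
have Zo t0 : Z t0 -> locally t0 Z.
  move=> H; have [e He] := proj1 (locally'P _ _) (locally'_open _ _ H).
  apply/locallyP; exists e => t Ht.
  case: (Req_dec t t0) => [-> // | Nt].
  exact: locally'_of (He t Ht Nt).
have Nzo t0 : ~ Z t0 -> locally t0 (fun t => ~ Z t).
  move=> H; case: (mero_dichotomy _ Hf t0) => // H'.
  have [e He] := proj1 (locally'P _ _) (locally'_open _ _ H').
  apply/locallyP; exists e => t Ht.
  case: (Req_dec t t0) => [-> // | Nt Zt].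
  apply: (locally'_proper t).
  generalize (filter_and _ _ (locally'_of _ _ (He t Ht Nt)) Zt).
  by apply: filter_imp => s [].
case: (classic (exists x, Z x)) => [[x Zx] | N]; last first.
  right=> t0; case: (mero_dichotomy _ Hf t0) => // H.
  by case: N; exists t0.
left=> y; change (Z y); apply: NNPP => Ny.
have [p Hp] : exists p : R -> R, forall t, (Z t -> p t = 1) /\ (~ Z t -> p t = -1).
  exists (fun t => match excluded_middle_informative (Z t) with left _ => 1 | right _ => -1 end).
  by move=> t; split=> Ht; destruct (excluded_middle_informative (Z t)).
have Cp : continuity p.
  move=> t; apply/continuity_pt_locally => e.
  case: (classic (Z t)) => Ht.
    apply: filter_imp (Zo t Ht) => s Hs.
    rewrite (proj1 (Hp s) Hs) (proj1 (Hp t) Ht) Rminus_diag Rabs_R0.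
    exact: cond_pos.
  apply: filter_imp (Nzo t Ht) => s Hs.
  rewrite (proj2 (Hp s) Hs) (proj2 (Hp t) Ht) Rminus_diag Rabs_R0.
  exact: cond_pos.
have P1 := proj1 (Hp x) Zx; have P2 := proj2 (Hp y) Ny.
have Hb : Rmin (p x) (p y) <= 0 <= Rmax (p x) (p y).
  rewrite P1 P2 Rmin_right; last lra.
  by rewrite Rmax_left; lra.
have [z [_ Hz]] := IVT_gen p x y 0 Cp Hb.
by case: (classic (Z z)) => Hz'; [have := proj1 (Hp z) Hz' | have := proj2 (Hp z) Hz']; lra.
Qed.

End Meromorphic.

From HB Require Import structures.
From mathcomp Require Import all_boot all_algebra.
From mathcomp Require Import generic_quotient ring_quotient.
From mathcomp Require boolp.
Set Implicit Arguments. Unset Strict Implicit. Unset Printing Implicit Defensive.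
Import GRing.Theory.
Delimit Scope R_scope with Re.

Record mfun := MFun { mfun_val :> R -> R; mfunP : meromorphic mfun_val }.

HB.instance Definition _ := boolp.gen_eqMixin mfun.
HB.instance Definition _ := boolp.gen_choiceMixin mfun.

Section MfunRing.
Local Open Scope R_scope.

Lemma mfun_ext (f g : mfun) : (forall t, f t = g t) -> f = g.
Proof.
case: f g => [f Hf] [g Hg] /= /boolp.funext E; subst g.
by rewrite (boolp.Prop_irrelevance Hf Hg).
Qed.

Definition mfun0 := MFun (mero_const 0).
Definition mfun1 := MFun (mero_const 1).
Definition mfun_add (f g : mfun) := MFun (mero_plus _ _ (mfunP f) (mfunP g)).
Definition mfun_mul (f g : mfun) := MFun (mero_mult _ _ (mfunP f) (mfunP g)).
Definition mfun_opp (f : mfun) := mfun_mul (MFun (mero_const (-1))) f.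
Definition mfun_shift tau (f : mfun) := MFun (mero_shift tau _ (mfunP f)).
Definition mfun_derive (f : mfun) := MFun (mero_derive _ (mfunP f)).

Lemma mfun_addA : associative mfun_add.
Proof. by move=> f g h; apply: mfun_ext => t /=; ring. Qed.
Lemma mfun_addC : commutative mfun_add.
Proof. by move=> f g; apply: mfun_ext => t /=; ring. Qed.
Lemma mfun_add0 : left_id mfun0 mfun_add.
Proof. by move=> f; apply: mfun_ext => t /=; ring. Qed.
Lemma mfun_addN : left_inverse mfun0 mfun_opp mfun_add.
Proof. by move=> f; apply: mfun_ext => t /=; ring. Qed.
Lemma mfun_mulA : associative mfun_mul.
Proof. by move=> f g h; apply: mfun_ext => t /=; ring. Qed.
Lemma mfun_mulC : commutative mfun_mul.
Proof. by move=> f g; apply: mfun_ext => t /=; ring. Qed.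
Lemma mfun_mul1 : left_id mfun1 mfun_mul.
Proof. by move=> f; apply: mfun_ext => t /=; ring. Qed.
Lemma mfun_mulDl : left_distributive mfun_mul mfun_add.
Proof. by move=> f g h; apply: mfun_ext => t /=; ring. Qed.
Lemma mfun_one_neq0 : mfun1 != mfun0.
Proof.
apply/eqP => /(f_equal (fun f : mfun => mfun_val f R0)) /=; exact: R1_neq_R0.
Qed.

HB.instance Definition _ :=
  GRing.isZmodule.Build mfun mfun_addA mfun_addC mfun_add0 mfun_addN.
HB.instance Definition _ := GRing.Zmodule_isComNzRing.Build mfun
  mfun_mulA mfun_mulC mfun_mul1 mfun_mulDl mfun_one_neq0.

Definition mnull : pred mfun := fun f => boolp.asbool (negligible f).

Lemma mnullP (f : mfun) : reflect (negligible f) (f \in mnull).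
Proof. exact: boolp.asboolP. Qed.

Lemma mnull_idealr : idealr_closed mnull.
Proof.
split.
- by apply/mnullP => t0; apply: locally'_of; apply: filter_forall.
- apply/negP => /mnullP /(_ R0) H; apply: (locally'_proper R0).
  by apply: filter_imp H => t /= /R1_neq_R0.
- move=> a f g /mnullP Hf /mnullP Hg; apply/mnullP => t0.
  generalize (filter_and _ _ (Hf t0) (Hg t0)); apply: filter_imp => t [Ef Eg] /=.
  by change (a t * f t + g t = 0); rewrite Ef Eg; ring.
Qed.

HB.instance Definition _ := isIdealr.Build mfun mnull mnull_idealr.
End MfunRing.

Local Open Scope ring_scope.

(* the field K: meromorphic functions modulo values at isolated points *)
Definition mero_ideal : idealr mfun := mnull.
Definition mero := {ideal_quot mero_ideal}.
HB.instance Definition _ := GRing.ComNzRing.on mero.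

Definition mero_of (f : mfun) : mero := \pi_mero%qT f.

Lemma mero_ofK (x : mero) : mero_of (repr x) = x.
Proof. exact: reprK. Qed.

Lemma mero_of_eq (f g : mfun) : reflect (negligible (f - g)) (mero_of f == mero_of g).
Proof. by rewrite /mero_of -Quotient.idealrBE; exact: mnullP. Qed.

Lemma mero_ofD f g : mero_of (f + g) = mero_of f + mero_of g.
Proof. by rewrite /mero_of (raddfD (\pi_mero%qT)). Qed.
Lemma mero_ofM f g : mero_of (f * g) = mero_of f * mero_of g.
Proof. by rewrite /mero_of rmorphM. Qed.
Lemma mero_of1 : mero_of 1 = 1.
Proof. by rewrite /mero_of rmorph1. Qed.

Lemma mero_inv_exists (x : mero) : x != 0 -> exists y : mero, y * x = 1.
Proof.
rewrite -{1}(mero_ofK x) -[x]mero_ofK -[0](rmorph0 (\pi_mero%qT)).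
set f := repr x; rewrite mero_ofK -/(mero_of 0) => /mero_of_eq nf.
have [zf | nz] := mero_null_or _ (mfunP f).
  by case: nf => t0; apply: filter_imp (zf t0) => t /= ->; ring.
exists (mero_of (MFun (mero_inv _ (mfunP f) nz))).
rewrite -mero_ofM -mero_of1; apply/eqP/mero_of_eq => t0.
apply: filter_imp (nz t0) => t /= nft.
by change (/ f t * f t + -1 * 1 = 0)%Re; field.
Qed.

Definition mero_invr (x : mero) : mero :=
  if boolp.pselect (x != 0) is left nz then projT1 (boolp.cid (mero_inv_exists nz)) else 0.

Lemma mero_mulVf (x : mero) : x != 0 -> mero_invr x * x = 1.
Proof.
rewrite /mero_invr; case: boolp.pselect => // nz _.
by case: boolp.cid.
Qed.

Lemma mero_invr0 : mero_invr 0 = 0.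
Proof. by rewrite /mero_invr; case: boolp.pselect => // nz; case/eqP: (nz). Qed.

HB.instance Definition _ := GRing.ComNzRing_isField.Build mero mero_mulVf mero_invr0.

Definition mero_delay (tau : R) (x : mero) : mero := mero_of (mfun_shift tau (repr x)).
Definition mero_deriv (x : mero) : mero := mero_of (mfun_derive (repr x)).

Lemma mero_ofP (f g : mfun) :
  (forall t0, locally' t0 (fun t => f t = g t)) <-> mero_of f = mero_of g.
Proof.
split=> [H | /eqP /mero_of_eq H t0].
  apply/eqP/mero_of_eq => t0; apply: filter_imp (H t0) => t E.
  by change (f t + -1 * g t = 0)%Re; rewrite E; ring.
apply: filter_imp (H t0) => t.
by change ((f t + -1 * g t = 0)%Re -> f t = g t) => ?; lra.
Qed.

Lemma mero_repr (f : mfun) t0 : locally' t0 (fun t => repr (mero_of f) t = f t).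
Proof. by move: t0; apply/mero_ofP; rewrite mero_ofK. Qed.

Lemma mero_delay_of tau f : mero_delay tau (mero_of f) = mero_of (mfun_shift tau f).
Proof.
apply/mero_ofP => t0.
have /locally'P [e He] := mero_repr f (t0 - tau)%Re.
apply/locally'P; exists e => t Ht Nt; apply: He; last by lra.
by replace (t - tau - (t0 - tau))%Re with (t - t0)%Re by ring.
Qed.

Lemma mero_deriv_of f : mero_deriv (mero_of f) = mero_of (mfun_derive f).
Proof.
apply/mero_ofP => t0; apply: filter_imp (locally'_open _ _ (mero_repr f t0)) => t.
exact: Derive_ext_loc.
Qed.

Lemma mero_delayB tau : zmod_morphism (mero_delay tau).
Proof.
move=> x y; rewrite -(mero_ofK x) -(mero_ofK y).
rewrite /mero_of -rmorphB -/mero_of !mero_delay_of -rmorphB.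
by congr (\pi_mero%qT _); exact: mfun_ext.
Qed.
Lemma mero_delayM tau : monoid_morphism (mero_delay tau).
Proof.
split; first by rewrite -mero_of1 mero_delay_of; congr mero_of; exact: mfun_ext.
move=> x y; rewrite -(mero_ofK x) -(mero_ofK y) -mero_ofM !mero_delay_of -mero_ofM.
by congr mero_of; exact: mfun_ext.
Qed.
HB.instance Definition _ tau :=
  GRing.isZmodMorphism.Build mero mero (mero_delay tau) (mero_delayB tau).
HB.instance Definition _ tau :=
  GRing.isMonoidMorphism.Build mero mero (mero_delay tau) (mero_delayM tau).

Lemma mero_derivD x y : mero_deriv (x + y) = mero_deriv x + mero_deriv y.
Proof.
rewrite -(mero_ofK x) -(mero_ofK y) -mero_ofD !mero_deriv_of -mero_ofD.
apply/mero_ofP => t0.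
generalize (filter_and _ _ (mero_ex_derive _ (mfunP (repr x)) t0)
  (mero_ex_derive _ (mfunP (repr y)) t0)).
by apply: filter_imp => t [Hx Hy]; exact: Derive_plus.
Qed.

Lemma mero_derivM x y :
  mero_deriv (x * y) = x * mero_deriv y + mero_deriv x * y.
Proof.
rewrite -{1 2}(mero_ofK x) -{1 3}(mero_ofK y) -mero_ofM !mero_deriv_of.
rewrite -!mero_ofM -mero_ofD.
apply/mero_ofP => t0.
generalize (filter_and _ _ (mero_ex_derive _ (mfunP (repr x)) t0)
  (mero_ex_derive _ (mfunP (repr y)) t0)).
apply: filter_imp => t [Hx Hy]; rewrite [LHS]Derive_mult //.
by rewrite Rplus_comm.
Qed.

Lemma mero_deriv_delay tau x :
  mero_deriv (mero_delay tau x) = mero_delay tau (mero_deriv x).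
Proof.
rewrite -(mero_ofK x) mero_delay_of !mero_deriv_of mero_delay_of.
congr mero_of; apply: mfun_ext => t /=; rewrite /shift_fun.
rewrite /Derive; congr (real _); apply: Lim_ext => h.
by congr (_ / _)%Re; congr (_ - _)%Re; congr (repr x _); ring.
Qed.

Definition skew_derivation (R : nzRingType) (s d : R -> R) : Prop :=
  (forall a b, d (a + b) = d a + d b) /\
  (forall a b, d (a * b) = s a * d b + d a * b).

(* left skew polynomials sum_i a_i x^i over R, with x a = s(a) x + d(a) *)
Definition ore (R : nzRingType) (s : {rmorphism R -> R}) (d : R -> R)
  (sd : skew_derivation s d) : Type := {poly R}.

Section Ore.
Variables (R : nzRingType) (s : {rmorphism R -> R}) (d : R -> R).
Hypothesis sd : skew_derivation s d.
Local Notation E := (ore sd).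

Definition ore_mulX (q : {poly R}) : {poly R} :=
  \poly_(i < (size q).+1) ((if i is j.+1 then s q`_j else 0) + d q`_i).

Definition ore_mul (p q : {poly R}) : {poly R} :=
  \sum_(i < size p) p`_i *: iter i ore_mulX q.

Implicit Types p q r : {poly R}.
Let dD := sd.1.
Let dM := sd.2.

Lemma skew_derivation0 : d 0 = 0.
Proof. by apply: (@addrI _ (d 0)); rewrite -dD !addr0. Qed.

Lemma skew_derivation1 : d 1 = 0.
Proof.
by apply: (@addrI _ (d 1)); rewrite addr0 -{3}[1]mulr1 dM rmorph1 mul1r mulr1.
Qed.

Lemma coef_ore_mulX q i :
  (ore_mulX q)`_i = (if i is j.+1 then s q`_j else 0) + d q`_i.
Proof.
rewrite coef_poly; case: ltnP => // lt; case: i lt => // i lt.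
have lt' : (size q <= i.+1)%N by exact: ltnW.
by rewrite (nth_default _ lt') (nth_default _ lt) rmorph0 skew_derivation0 addr0.
Qed.

Lemma ore_mulXD p q : ore_mulX (p + q) = ore_mulX p + ore_mulX q.
Proof.
apply/polyP => i; rewrite coefD !coef_ore_mulX !coefD dD.
by case: i => [|i]; rewrite ?coefD ?rmorphD ?add0r // addrACA.
Qed.

Lemma ore_mulXZ a p : ore_mulX (a *: p) = s a *: ore_mulX p + d a *: p.
Proof.
apply/polyP => i; rewrite coefD !coefZ !coef_ore_mulX !coefZ dM mulrDr.
by case: i => [|i]; rewrite ?coefZ ?rmorphM ?mulr0 ?add0r // addrA.
Qed.

Lemma ore_mulX0 : ore_mulX 0 = 0.
Proof. by apply: (@addrI _ (ore_mulX 0)); rewrite -ore_mulXD !addr0. Qed.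

Lemma ore_mulX_sum (I : Type) (r : seq I) (F : I -> {poly R}) :
  ore_mulX (\sum_(i <- r) F i) = \sum_(i <- r) ore_mulX (F i).
Proof. exact: (big_morph _ ore_mulXD ore_mulX0). Qed.

Lemma iter_ore_mulXD i p q :
  iter i ore_mulX (p + q) = iter i ore_mulX p + iter i ore_mulX q.
Proof. by elim: i => //= i ->; rewrite ore_mulXD. Qed.

Lemma ore_mulE n (p q : {poly R}) : (size p <= n)%N ->
  ore_mul p q = \sum_(i < n) p`_i *: iter i ore_mulX q.
Proof.
move=> le; rewrite /ore_mul (big_ord_widen n (fun i => p`_i *: iter i ore_mulX q) le) big_mkcond /=.
apply: eq_bigr => i _; case: ltnP => // H.
by rewrite nth_default // scale0r.
Qed.

Lemma ore_mulDl : left_distributive ore_mul +%R.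
Proof.
move=> p q r; set n := maxn (size p) (size q).
rewrite !(@ore_mulE n) ?leq_maxl ?leq_maxr ?size_polyD // -big_split /=.
by apply: eq_bigr => i _; rewrite coefD scalerDl.
Qed.

Lemma ore_mulDr : right_distributive ore_mul +%R.
Proof.
move=> p q r; rewrite -big_split /=.
by apply: eq_bigr => i _; rewrite iter_ore_mulXD scalerDr.
Qed.

Lemma ore_mul0l q : ore_mul 0 q = 0.
Proof. by rewrite /ore_mul size_poly0 big_ord0. Qed.

Lemma ore_mulZl a p q : ore_mul (a *: p) q = a *: ore_mul p q.
Proof.
rewrite (@ore_mulE (size p)) ?size_scale_leq // scaler_sumr.
by apply: eq_bigr => i _; rewrite coefZ scalerA.
Qed.

Lemma ore_mulXl p q : ore_mul (ore_mulX p) q = ore_mulX (ore_mul p q).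
Proof.
rewrite (@ore_mulE (size p).+1) ?size_poly // ore_mulX_sum.
under eq_bigr do rewrite coef_ore_mulX scalerDl.
under [RHS]eq_bigr do rewrite ore_mulXZ.
rewrite !big_split /= big_ord_recl /= scale0r add0r; congr (_ + _).
by rewrite big_ord_recr /= nth_default // skew_derivation0 scale0r addr0.
Qed.

Lemma ore_mulA : associative ore_mul.
Proof.
move=> p q r; rewrite {2}/ore_mul.
rewrite (big_morph (fun p => ore_mul p r) (fun x y => ore_mulDl x y r)
  (ore_mul0l r)).
apply: eq_bigr => i _; rewrite ore_mulZl; congr (_ *: _).
by elim: (i : nat) => //= j ->; rewrite ore_mulXl.
Qed.

Lemma ore_mul1l : left_id 1 ore_mul.
Proof.
by move=> q; rewrite /ore_mul size_poly1 big_ord1 coef1 scale1r.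
Qed.

Lemma ore_mulXn i : iter i ore_mulX 1 = 'X^i.
Proof.
elim: i => //= i ->; apply/polyP => j; rewrite coef_ore_mulX.
have -> : d 'X^i`_j = 0.
  by rewrite coefXn; case: eqP => _; rewrite ?skew_derivation1 ?skew_derivation0.
by case: j => [|j]; rewrite addr0 !coefXn // rmorph_nat.
Qed.

Lemma ore_mul1r : right_id 1 ore_mul.
Proof.
move=> p; rewrite -[RHS]coefK poly_def.
by apply: eq_bigr => i _; rewrite ore_mulXn.
Qed.

HB.instance Definition _ := GRing.Zmodule.on E.
HB.instance Definition _ := GRing.Zmodule_isNzRing.Build E
  ore_mulA ore_mul1l ore_mul1r ore_mulDl ore_mulDr (oner_neq0 {poly R}).

Definition oreC (a : R) : E := a%:P.
Definition oreX : E := ('X : {poly R}).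

Lemma oreX_mul (p : E) : oreX * p = ore_mulX p.
Proof.
have -> : oreX = ore_mulX 1 by rewrite /oreX -['X]expr1 -ore_mulXn.
by rewrite [LHS]ore_mulXl ore_mul1l.
Qed.

Lemma oreX_mulC (a : R) : oreX * oreC a = oreC (s a) * oreX + oreC (d a).
Proof.
rewrite oreX_mul; change (ore_mulX a%:P = ore_mul (s a)%:P 'X + (d a)%:P).
have -> : ore_mul (s a)%:P 'X = s a *: 'X.
  by rewrite -alg_polyC ore_mulZl ore_mul1l.
have X1 : ore_mulX 1 = 'X := ore_mulXn 1.
by rewrite -[a%:P]alg_polyC ore_mulXZ X1 alg_polyC.
Qed.
End Ore.

Definition left_ore_domain (R : nzRingType) : Prop :=
  (forall a b : R, a * b = 0 -> a = 0 \/ b = 0) /\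
  (forall a b : R, b != 0 -> exists u v, v != 0 /\ u * b = v * a).

(* A left fraction q is encoded by the graph {(r, w) | r q = w} of right
   multiplication by q; v^-1 u is the unique fraction whose graph contains
   (v, u). Such graphs are the maximal R-linear partial maps of R. *)
Record lfrac (R : nzRingType) (ore_R : left_ore_domain R) := LFrac {
  fgraph : R -> R -> Prop;
  fgraph_dom : exists v u, v != 0 /\ fgraph v u;
  fgraph_fun : forall w, fgraph 0 w -> w = 0;
  fgraph_lin : forall a r w r' w',
    fgraph r w -> fgraph r' w' -> fgraph (a * r + r') (a * w + w');
  fgraph_sat : forall a r w, a != 0 -> fgraph (a * r) (a * w) -> fgraph r w
}.

Section LeftFractions.
Variables (R : nzRingType) (ore_R : left_ore_domain R).
Local Notation Q := (lfrac ore_R).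
Implicit Types (G H K : Q) (a b r u v w : R).

HB.instance Definition _ := boolp.gen_eqMixin Q.
HB.instance Definition _ := boolp.gen_choiceMixin Q.

Let dom a b : a * b = 0 -> a = 0 \/ b = 0 := ore_R.1 a b.

Lemma dom_mulf_neq0 a b : a != 0 -> b != 0 -> a * b != 0.
Proof. by move=> na nb; apply/eqP => /dom [] /eqP; apply/negP. Qed.

Lemma dom_mulIf a b c : c != 0 -> a * c = b * c -> a = b.
Proof.
move=> nc E; have /dom [/subr0_eq //| /eqP] : (a - b) * c = 0.
  by rewrite mulrBl E subrr.
by rewrite (negPf nc).
Qed.

Lemma dom_mulfI a b c : c != 0 -> c * a = c * b -> a = b.
Proof.
move=> nc E; have /dom [/eqP | /subr0_eq //] : c * (a - b) = 0.
  by rewrite mulrBr E subrr.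
by rewrite (negPf nc).
Qed.

Lemma dom_ore a b : b != 0 -> exists u v, v != 0 /\ u * b = v * a.
Proof. exact: ore_R.2. Qed.

Lemma fgraph00 G : fgraph G 0 0.
Proof.
have [v [u [_ H]]] := fgraph_dom G.
by have := fgraph_lin (-1) H H; rewrite !mulN1r !addNr.
Qed.

Lemma fgraphM G a r w : fgraph G r w -> fgraph G (a * r) (a * w).
Proof. by move=> H; have := fgraph_lin a H (fgraph00 G); rewrite !addr0. Qed.

Lemma fgraph_inj G r w w' : fgraph G r w -> fgraph G r w' -> w = w'.
Proof.
move=> H H'; have := fgraph_lin (-1) H H'; rewrite !mulN1r addNr.
by move=> /fgraph_fun /eqP; rewrite addrC subr_eq0 => /eqP.
Qed.

Lemma fgraph_total G r : exists a w, a != 0 /\ fgraph G (a * r) w.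
Proof.
have [v [u [nv H]]] := fgraph_dom G.
have [b [a [na E]]] := dom_ore r nv.
by exists a, (b * u); split=> //; rewrite -E; exact: fgraphM.
Qed.

Lemma lfrac_val_inj G H : fgraph G = fgraph H -> G = H.
Proof.
case: G H => [g g1 g2 g3 g4] [h h1 h2 h3 h4] /= E; subst h.
by congr LFrac; exact: boolp.Prop_irrelevance.
Qed.

Lemma lfrac_eq G H v u : v != 0 -> fgraph G v u -> fgraph H v u -> G = H.
Proof.
have sub (G1 G2 : Q) : v != 0 -> fgraph G1 v u -> fgraph G2 v u ->
    forall r w, fgraph G1 r w -> fgraph G2 r w.
  move=> nv h1 h2 r w h; have [b [a [na E]]] := dom_ore r nv.
  apply: (fgraph_sat na); have h1' := fgraphM b h1; rewrite E in h1'.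
  by rewrite (fgraph_inj (fgraphM a h) h1') -E; exact: fgraphM.
move=> nv h1 h2; apply: lfrac_val_inj.
apply/boolp.funext => r; apply/boolp.funext => w.
by apply/boolp.propext; split; exact: sub.
Qed.

Definition lfrac_of_rel a r w := w = r * a.
Lemma lfrac_of_subproof a :
  [/\ exists v u, v != 0 /\ lfrac_of_rel a v u,
      forall w, lfrac_of_rel a 0 w -> w = 0,
      forall b r w r' w', lfrac_of_rel a r w -> lfrac_of_rel a r' w' ->
        lfrac_of_rel a (b * r + r') (b * w + w')
    & forall b r w, b != 0 -> lfrac_of_rel a (b * r) (b * w) -> lfrac_of_rel a r w].
Proof.
rewrite /lfrac_of_rel; split.
- by exists 1, a; rewrite oner_neq0 mul1r.
- by move=> w ->; rewrite mul0r.
- by move=> b r w r' w' -> ->; rewrite mulrDl mulrA.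
- by move=> b r w nb; rewrite -mulrA; exact: dom_mulfI.
Qed.
Definition lfrac_of a : Q :=
  let: And4 h1 h2 h3 h4 := lfrac_of_subproof a in LFrac ore_R h1 h2 h3 h4.

Lemma lfrac_ofE a r w : fgraph (lfrac_of a) r w = (w = r * a).
Proof. by rewrite /lfrac_of; case: lfrac_of_subproof. Qed.

Definition lfrac_add_rel G H r w :=
  exists a w1 w2, [/\ a != 0, fgraph G (a * r) w1, fgraph H (a * r) w2
                    & a * w = w1 + w2].

Lemma lfrac_dom2 G H : exists r w1 w2, [/\ r != 0, fgraph G r w1 & fgraph H r w2].
Proof.
have [v [u [nv h]]] := fgraph_dom G; have [a [w [na h']]] := fgraph_total H v.
exists (a * v), (a * u), w; split=> //; first exact: dom_mulf_neq0.
exact: fgraphM.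
Qed.

Lemma lfrac_add_subproof G H :
  [/\ exists v u, v != 0 /\ lfrac_add_rel G H v u,
      forall w, lfrac_add_rel G H 0 w -> w = 0,
      forall b r w r' w', lfrac_add_rel G H r w -> lfrac_add_rel G H r' w' ->
        lfrac_add_rel G H (b * r + r') (b * w + w')
    & forall b r w, b != 0 -> lfrac_add_rel G H (b * r) (b * w) ->
        lfrac_add_rel G H r w].
Proof.
split.
- have [r [w1 [w2 [nr h1 h2]]]] := lfrac_dom2 G H.
  exists r, (w1 + w2); split=> //; exists 1, w1, w2.
  by split; rewrite ?oner_neq0 ?mul1r.
- move=> w [a [w1 [w2 [na]]]]; rewrite mulr0 => /fgraph_fun -> /fgraph_fun ->.
  by rewrite addr0 => /dom [] // /eqP; rewrite (negPf na).
- move=> b r w r' w' [a [w1 [w2 [na h1 h2 E]]]] [a' [w1' [w2' [na' h1' h2' E']]]].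
  have [e [c [nc Ec]]] := dom_ore b na.
  have [e' [c' [nc' Ec']]] := dom_ore c na'.
  have nm : c' * c != 0 by exact: dom_mulf_neq0.
  have Eb : (c' * c) * b = (c' * e) * a by rewrite -mulrA -Ec mulrA.
  exists (c' * c), ((c' * e) * w1 + e' * w1'), ((c' * e) * w2 + e' * w2').
  have X x x' : (c' * c) * (b * x + x') = (c' * e) * (a * x) + e' * (a' * x').
    by rewrite mulrDr !mulrA Eb -!mulrA !(mulrA e') Ec' !mulrA.
  split=> //; rewrite X.
  + by apply: fgraph_lin => //; exact: fgraphM.
  + by apply: fgraph_lin => //; exact: fgraphM.
  + by rewrite E E' !mulrDr addrACA.
- move=> b r w nb [a [w1 [w2 [na h1 h2 E]]]]; exists (a * b), w1, w2.
  by split; rewrite -?mulrA //; exact: dom_mulf_neq0.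
Qed.
Definition lfrac_add G H : Q :=
  let: And4 h1 h2 h3 h4 := lfrac_add_subproof G H in LFrac ore_R h1 h2 h3 h4.

Lemma fgraph_add G H r w1 w2 :
  fgraph G r w1 -> fgraph H r w2 -> fgraph (lfrac_add G H) r (w1 + w2).
Proof.
move=> h1 h2; rewrite /lfrac_add; case: lfrac_add_subproof => /= *.
by exists 1, w1, w2; rewrite !mul1r oner_neq0.
Qed.

Definition lfrac_mul_rel G H r w :=
  exists a t, [/\ a != 0, fgraph G (a * r) t & fgraph H t (a * w)].

Lemma lfrac_mul_subproof G H :
  [/\ exists v u, v != 0 /\ lfrac_mul_rel G H v u,
      forall w, lfrac_mul_rel G H 0 w -> w = 0,
      forall b r w r' w', lfrac_mul_rel G H r w -> lfrac_mul_rel G H r' w' ->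
        lfrac_mul_rel G H (b * r + r') (b * w + w')
    & forall b r w, b != 0 -> lfrac_mul_rel G H (b * r) (b * w) ->
        lfrac_mul_rel G H r w].
Proof.
split.
- have [v [u [nv h]]] := fgraph_dom G; have [a [w [na h']]] := fgraph_total H u.
  exists (a * v), w; split; first exact: dom_mulf_neq0.
  exists 1, (a * u); split; rewrite ?oner_neq0 ?mul1r //; exact: fgraphM.
- move=> w [a [t [na]]]; rewrite mulr0 => /fgraph_fun -> /fgraph_fun.
  by move=> /dom [] // /eqP; rewrite (negPf na).
- move=> b r w r' w' [a [t [na h1 h2]]] [a' [t' [na' h1' h2']]].
  have [e [c [nc Ec]]] := dom_ore b na.
  have [e' [c' [nc' Ec']]] := dom_ore c na'.
  have nm : c' * c != 0 by exact: dom_mulf_neq0.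
  have Eb : (c' * c) * b = (c' * e) * a by rewrite -mulrA -Ec mulrA.
  have X x x' : (c' * c) * (b * x + x') = (c' * e) * (a * x) + e' * (a' * x').
    by rewrite mulrDr !mulrA Eb -!mulrA !(mulrA e') Ec' !mulrA.
  exists (c' * c), ((c' * e) * t + e' * t').
  by split=> //; rewrite X; apply: fgraph_lin => //; exact: fgraphM.
- move=> b r w nb [a [t [na h1 h2]]]; exists (a * b), t.
  by split; rewrite -?mulrA //; exact: dom_mulf_neq0.
Qed.
Definition lfrac_mul G H : Q :=
  let: And4 h1 h2 h3 h4 := lfrac_mul_subproof G H in LFrac ore_R h1 h2 h3 h4.

Lemma fgraph_mul G H r t w :
  fgraph G r t -> fgraph H t w -> fgraph (lfrac_mul G H) r w.
Proof.
move=> h1 h2; rewrite /lfrac_mul; case: lfrac_mul_subproof => /= *.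
by exists 1, t; rewrite !mul1r oner_neq0.
Qed.

Definition lfrac_opp G : Q := lfrac_mul (lfrac_of (-1)) G.

Lemma fgraph_of a r : fgraph (lfrac_of a) r (r * a).
Proof. by rewrite lfrac_ofE. Qed.

Lemma fgraph_opp G r w : fgraph G r w -> fgraph (lfrac_opp G) r (- w).
Proof.
move=> h; apply: fgraph_mul (fgraph_of _ _) _.
by rewrite mulrN1; have := fgraphM (-1) h; rewrite !mulN1r.
Qed.

Lemma lfrac_dom3 G H K : exists r w1 w2 w3,
  [/\ r != 0, fgraph G r w1, fgraph H r w2 & fgraph K r w3].
Proof.
have [v [w1 [w2 [nv h1 h2]]]] := lfrac_dom2 G H.
have [a [w [na h']]] := fgraph_total K v.
exists (a * v), (a * w1), (a * w2), w; split=> //; last 2 first.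
- exact: fgraphM.
- exact: fgraphM.
- exact: dom_mulf_neq0.
Qed.

Lemma lfrac_addA : associative lfrac_add.
Proof.
move=> G H K; have [r [w1 [w2 [w3 [nr h1 h2 h3]]]]] := lfrac_dom3 G H K.
apply: (lfrac_eq (u := w1 + (w2 + w3)) nr); first by do 2?apply: fgraph_add.
by rewrite addrA; do 2?apply: fgraph_add.
Qed.

Lemma lfrac_addC : commutative lfrac_add.
Proof.
move=> G H; have [r [w1 [w2 [nr h1 h2]]]] := lfrac_dom2 G H.
apply: (lfrac_eq (u := w1 + w2) nr); first exact: fgraph_add.
by rewrite addrC; exact: fgraph_add.
Qed.

Lemma lfrac_add0 : left_id (lfrac_of 0) lfrac_add.
Proof.
move=> G; have [r [w [nr h]]] := fgraph_dom G.
apply: (lfrac_eq (u := w) nr) => //.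
by rewrite -[w]add0r; apply: fgraph_add => //; rewrite lfrac_ofE mulr0.
Qed.

Lemma lfrac_addN : left_inverse (lfrac_of 0) lfrac_opp lfrac_add.
Proof.
move=> G; have [r [w [nr h]]] := fgraph_dom G.
apply: (lfrac_eq (u := 0) nr); last by rewrite lfrac_ofE mulr0.
by rewrite -(addNr w); apply: fgraph_add => //; exact: fgraph_opp.
Qed.

Lemma lfrac_chain G H : exists r t w, [/\ r != 0, fgraph G r t & fgraph H t w].
Proof.
have [v [u [nv h]]] := fgraph_dom G; have [a [w [na h']]] := fgraph_total H u.
exists (a * v), (a * u), w; split=> //; first exact: dom_mulf_neq0.
exact: fgraphM.
Qed.

Lemma lfrac_mulA : associative lfrac_mul.
Proof.
move=> G H K; have [r [t [w [nr h1 h2]]]] := lfrac_chain G H.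
have [a [x [na h3]]] := fgraph_total K w.
apply: (@lfrac_eq _ _ (a * r) x); first exact: dom_mulf_neq0.
  by do 2?[apply: fgraph_mul (fgraphM a _) _; first eassumption].
by apply: fgraph_mul h3; apply: fgraph_mul (fgraphM a h1) (fgraphM a h2).
Qed.

Lemma lfrac_mul1l : left_id (lfrac_of 1) lfrac_mul.
Proof.
move=> G; have [r [w [nr h]]] := fgraph_dom G.
by apply: (lfrac_eq (u := w) nr) => //; apply: fgraph_mul h; rewrite lfrac_ofE mulr1.
Qed.

Lemma lfrac_mul1r : right_id (lfrac_of 1) lfrac_mul.
Proof.
move=> G; have [r [w [nr h]]] := fgraph_dom G.
by apply: (lfrac_eq (u := w) nr) => //; apply: fgraph_mul h _; rewrite lfrac_ofE mulr1.
Qed.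

Lemma lfrac_mulDl : left_distributive lfrac_mul lfrac_add.
Proof.
move=> G H K; have [r [t1 [t2 [nr h1 h2]]]] := lfrac_dom2 G H.
have [a [w1 [na k1]]] := fgraph_total K t1.
have [b [w2 [nb k2]]] := fgraph_total K (a * t2).
apply: (@lfrac_eq _ _ (b * (a * r)) (b * w1 + w2)).
- by do 2?apply: dom_mulf_neq0.
- apply: (@fgraph_mul _ _ _ (b * (a * t1) + b * (a * t2))).
    by apply: fgraph_add; do 2?apply: fgraphM.
  exact: fgraph_lin.
- have e1 : fgraph G (b * (a * r)) (b * (a * t1)) by do 2!apply: fgraphM.
  have e2 : fgraph H (b * (a * r)) (b * (a * t2)) by do 2!apply: fgraphM.
  apply: fgraph_add; last exact: fgraph_mul e2 k2.
  by apply: fgraph_mul e1 _; exact: fgraphM.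
Qed.

Lemma lfrac_mulDr : right_distributive lfrac_mul lfrac_add.
Proof.
move=> K G H; have [r [t [nr k]]] := fgraph_dom K.
have [a [w1 [na h1]]] := fgraph_total G t.
have [b [w2 [nb h2]]] := fgraph_total H (a * t).
have kt : fgraph K (b * (a * r)) (b * (a * t)) by do 2!apply: fgraphM.
apply: (@lfrac_eq _ _ (b * (a * r)) (b * w1 + w2)).
- by do 2!apply: dom_mulf_neq0 => //.
- by apply: fgraph_mul kt _; apply: fgraph_add => //; exact: fgraphM.
- apply: fgraph_add; last exact: fgraph_mul kt h2.
  by apply: fgraph_mul kt _; exact: fgraphM.
Qed.

Lemma lfrac_of_inj : injective lfrac_of.
Proof.
by move=> a b /(f_equal (fun G : Q => fgraph G 1 a)); rewrite !lfrac_ofE !mul1r => <-.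
Qed.

Lemma lfrac_one_neq0 : lfrac_of 1 != lfrac_of 0.
Proof. by apply/eqP => /lfrac_of_inj /eqP; rewrite oner_eq0. Qed.

HB.instance Definition _ := GRing.isZmodule.Build Q
  lfrac_addA lfrac_addC lfrac_add0 lfrac_addN.
HB.instance Definition _ := GRing.Zmodule_isNzRing.Build Q
  lfrac_mulA lfrac_mul1l lfrac_mul1r lfrac_mulDl lfrac_mulDr lfrac_one_neq0.

Lemma lfrac_ofB : zmod_morphism lfrac_of.
Proof.
move=> a b; apply: (lfrac_eq (oner_neq0 R) (fgraph_of _ _)).
by rewrite mulrBr; apply: fgraph_add; [|apply: fgraph_opp]; exact: fgraph_of.
Qed.
Lemma lfrac_ofM : monoid_morphism lfrac_of.
Proof.
split=> // a b; apply: (lfrac_eq (oner_neq0 R) (fgraph_of _ _)).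
by rewrite mulrA; apply: fgraph_mul; exact: fgraph_of.
Qed.
HB.instance Definition _ := GRing.isZmodMorphism.Build R Q lfrac_of lfrac_ofB.
HB.instance Definition _ := GRing.isMonoidMorphism.Build R Q lfrac_of lfrac_ofM.

Lemma fgraphE G v u : fgraph G v u <-> lfrac_of v * G = lfrac_of u.
Proof.
split=> [h | E].
  apply: (lfrac_eq (oner_neq0 R) _ (fgraph_of _ _)).
  by rewrite mul1r; apply: fgraph_mul h; rewrite -{2}[v]mul1r; exact: fgraph_of.
have [a [w [na h]]] := fgraph_total G v.
apply: (fgraph_sat na); suff -> : a * u = w by [].
apply: lfrac_of_inj; rewrite rmorphM /= -E mulrA -rmorphM /=.
apply: (lfrac_eq (oner_neq0 R) _ (fgraph_of _ _)).
rewrite mul1r; apply: fgraph_mul h; rewrite -{2}[_ * v]mul1r; exact: fgraph_of.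
Qed.

Lemma lfracP G : exists v u, v != 0 /\ lfrac_of v * G = lfrac_of u.
Proof.
by have [v [u [nv /fgraphE h]]] := fgraph_dom G; exists v, u.
Qed.

Lemma lfrac_pairP G : exists p, p.1 != 0 /\ lfrac_of p.1 * G = lfrac_of p.2.
Proof. by have [v [u H]] := lfracP G; exists (v, u). Qed.
Definition lfrac_repr G : R * R := projT1 (boolp.cid (lfrac_pairP G)).
Lemma lfrac_reprP G :
  (lfrac_repr G).1 != 0 /\ lfrac_of (lfrac_repr G).1 * G = lfrac_of (lfrac_repr G).2.
Proof. exact: projT2 (boolp.cid (lfrac_pairP G)). Qed.

Definition lfrac_inv_rel G r w := if G == 0 then w = 0 else fgraph G w r.
Lemma lfrac_inv_subproof G :
  [/\ exists v u, v != 0 /\ lfrac_inv_rel G v u,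
      forall w, lfrac_inv_rel G 0 w -> w = 0,
      forall b r w r' w', lfrac_inv_rel G r w -> lfrac_inv_rel G r' w' ->
        lfrac_inv_rel G (b * r + r') (b * w + w')
    & forall b r w, b != 0 -> lfrac_inv_rel G (b * r) (b * w) ->
        lfrac_inv_rel G r w].
Proof.
rewrite /lfrac_inv_rel; case: eqP => [_|/eqP nG].
  split=> [||b r w r' w' -> ->|b r w nb /dom []] //.
  - by exists 1, 0; rewrite oner_neq0.
  - by rewrite mulr0 addr0.
  - by move/eqP; rewrite (negPf nb).
have nz r : fgraph G r 0 -> r = 0.
  move=> h; apply/eqP; apply: contraNT nG => nr.
  by apply/eqP; apply: (lfrac_eq nr h); rewrite lfrac_ofE mulr0.
split=> //.
- have [v [u [nv h]]] := fgraph_dom G; exists u, v; split=> //.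
  by apply: contraNneq nv => u0; rewrite u0 in h; rewrite (nz _ h).
- by move=> b r w r' w'; exact: fgraph_lin.
- by move=> b r w nb; exact: fgraph_sat.
Qed.
Definition lfrac_inv G : Q :=
  let: And4 h1 h2 h3 h4 := lfrac_inv_subproof G in LFrac ore_R h1 h2 h3 h4.

Lemma fgraph_inv G r w : G != 0 -> fgraph G r w -> fgraph (lfrac_inv G) w r.
Proof.
move=> nG h; rewrite /lfrac_inv; case: lfrac_inv_subproof => /= *.
by rewrite /lfrac_inv_rel (negPf nG).
Qed.

Lemma lfrac_inv0 : lfrac_inv 0 = 0.
Proof.
apply: (@lfrac_eq _ _ 1 0); rewrite ?oner_neq0 ?lfrac_ofE ?mulr0 //.
rewrite /lfrac_inv; case: lfrac_inv_subproof => /= *.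
by rewrite /lfrac_inv_rel eqxx.
Qed.

Definition lfrac_unit : pred Q := fun G => G != 0.

Lemma lfrac_mulVr : {in lfrac_unit, left_inverse 1 lfrac_inv *%R}.
Proof.
move=> G nG; have [v [u [nv h]]] := fgraph_dom G.
have nu : u != 0.
  apply: contraNneq nG => u0; rewrite u0 in h.
  by apply/eqP; apply: (lfrac_eq nv h); rewrite lfrac_ofE mulr0.
apply: (lfrac_eq nu (fgraph_mul (fgraph_inv nG h) h)).
by rewrite lfrac_ofE mulr1.
Qed.
Lemma lfrac_mulrV : {in lfrac_unit, right_inverse 1 lfrac_inv *%R}.
Proof.
move=> G nG; have [v [u [nv h]]] := fgraph_dom G.
apply: (lfrac_eq nv (fgraph_mul h (fgraph_inv nG h))).
by rewrite lfrac_ofE mulr1.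
Qed.
Lemma lfrac_unitP G H : H * G = 1 /\ G * H = 1 -> lfrac_unit G.
Proof.
move=> [E _]; apply/eqP => G0; move: E; rewrite G0 mulr0 => /eqP.
by rewrite eq_sym oner_eq0.
Qed.
Lemma lfrac_inv_out : {in [predC lfrac_unit], lfrac_inv =1 id}.
Proof. by move=> G; rewrite !inE negbK => /eqP ->; exact: lfrac_inv0. Qed.
HB.instance Definition _ := GRing.NzRing_hasMulInverse.Build Q
  lfrac_mulVr lfrac_mulrV lfrac_unitP lfrac_inv_out.

Lemma lfrac_unitE G : (G \is a GRing.unit) = (G != 0).
Proof. by []. Qed.

Section Derivation.
Variables (D : R -> R) (D_der : skew_derivation idfun D).

(* D (v^-1 u) = v^-1 (D u - D v v^-1 u) *)
Definition lfrac_deriv G : Q :=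
  let: (v, u) := lfrac_repr G in
  (lfrac_of v)^-1 * (lfrac_of (D u) - lfrac_of (D v) * G).

Lemma lfrac_derivE G v u : lfrac_of v * G = lfrac_of u ->
  lfrac_of v * lfrac_deriv G = lfrac_of (D u) - lfrac_of (D v) * G.
Proof.
move=> E; rewrite /lfrac_deriv.
case: (lfrac_repr G) (lfrac_reprP G) => v0 u0 /= [nv0 E0].
have [a [b [nb Eab]]] := dom_ore v nv0.
have nb' : lfrac_of b \is a GRing.unit.
  by rewrite lfrac_unitE -(rmorph0 lfrac_of) (inj_eq lfrac_of_inj).
have nv0' : lfrac_of v0 \is a GRing.unit.
  by rewrite lfrac_unitE -(rmorph0 lfrac_of) (inj_eq lfrac_of_inj).
have Eu : a * u0 = b * u.
  by apply: lfrac_of_inj; rewrite !rmorphM /= -E -E0 !mulrA -!rmorphM /= Eab.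
have Dl x y : lfrac_of x * lfrac_of (D y) =
    lfrac_of (D (x * y)) - lfrac_of (D x) * lfrac_of y.
  by rewrite D_der.2 rmorphD !rmorphM /= addrK.
have X c x y : lfrac_of x * G = lfrac_of y ->
    lfrac_of c * (lfrac_of (D y) - lfrac_of (D x) * G) =
    lfrac_of (D (c * y)) - lfrac_of (D (c * x)) * G.
  move=> Exy; rewrite mulrBr mulrA !Dl mulrBl opprB -[_ * _ * G]mulrA Exy.
  by rewrite addrA addrNK.
apply: (mulrI nb'); rewrite X // mulrA -rmorphM /= -Eab rmorphM /= -mulrA mulVKr //.
by rewrite X // Eu Eab.
Qed.

Lemma lfrac_deriv_of a : lfrac_deriv (lfrac_of a) = lfrac_of (D a).
Proof.
have := @lfrac_derivE (lfrac_of a) 1 a; rewrite rmorph1 mul1r => /(_ erefl).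
by rewrite mul1r (skew_derivation1 (s := idfun) D_der) rmorph0 mul0r subr0.
Qed.

Lemma lfrac_deriv_der : skew_derivation idfun lfrac_deriv.
Proof.
split=> G H.
- have [r [w1 [w2 [nr h1 h2]]]] := lfrac_dom2 G H.
  have nr' : lfrac_of r \is a GRing.unit.
    by rewrite lfrac_unitE -(rmorph0 lfrac_of) (inj_eq lfrac_of_inj).
  move/fgraphE: h1 => h1; move/fgraphE: h2 => h2.
  apply: (mulrI nr'); rewrite mulrDr (lfrac_derivE h1) (lfrac_derivE h2).
  rewrite (@lfrac_derivE _ _ (w1 + w2)); last by rewrite mulrDr h1 h2 rmorphD.
  by rewrite D_der.1 rmorphD mulrDr opprD addrACA.
- have [r [t [w [nr h1 h2]]]] := lfrac_chain G H.
  have nr' : lfrac_of r \is a GRing.unit.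
    by rewrite lfrac_unitE -(rmorph0 lfrac_of) (inj_eq lfrac_of_inj).
  move/fgraphE: h1 => h1; move/fgraphE: h2 => h2.
  apply: (mulrI nr'); rewrite mulrDr !mulrA h1 (lfrac_derivE h1) (lfrac_derivE h2).
  rewrite (@lfrac_derivE _ _ w); last by rewrite mulrA h1.
  by rewrite mulrBl addrA addrNK mulrA.
Qed.
End Derivation.
End LeftFractions.

Section OreField.
Variables (F : fieldType) (s : {rmorphism F -> F}) (d : F -> F).
Hypothesis sd : skew_derivation s d.
Local Notation E := (ore sd).
Local Notation mulX := (ore_mulX s d).
Implicit Types p q r : {poly F}.

Lemma size_ore_mulX q : q != 0 ->
  size (mulX q) = (size q).+1 /\ lead_coef (mulX q) = s (lead_coef q).
Proof.
move=> nq; have c : (mulX q)`_(size q) = s (lead_coef q).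
  rewrite (coef_ore_mulX sd) (nth_default 0 (leqnn (size q))).
  rewrite (skew_derivation0 sd) addr0 lead_coefE.
  by case: (size q) (size_poly_gt0 q) => [|n] //; rewrite nq.
have sz : size (mulX q) = (size q).+1.
  apply/eqP; rewrite eqn_leq size_poly /= ltnNge; apply/negP => le.
  by move/eqP: c; rewrite nth_default // eq_sym fmorph_eq0 lead_coef_eq0 (negPf nq).
by rewrite lead_coefE sz.
Qed.

Lemma size_iter_ore_mulX i q : q != 0 ->
  size (iter i mulX q) = (i + size q)%N /\
  lead_coef (iter i mulX q) = iter i s (lead_coef q).
Proof.
move=> nq; elim: i => //= i [IH1 IH2].
have nz : iter i mulX q != 0 by rewrite -size_poly_gt0 IH1 addn_gt0 size_poly_gt0 nq orbT.
by have [-> ->] := size_ore_mulX nz; rewrite IH1 IH2.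
Qed.

Lemma iter_fmorph_neq0 i (a : F) : a != 0 -> iter i s a != 0.
Proof. by move=> na; elim: i => //= i; rewrite fmorph_eq0. Qed.

Lemma size_ore_mul p q : p != 0 -> q != 0 ->
  size (ore_mul s d p q) = (size p + size q).-1.
Proof.
move=> np nq; rewrite /ore_mul.
have : lead_coef p != 0 by rewrite lead_coef_eq0.
rewrite lead_coefE; case: (size p) (size_poly_gt0 p) => [|n]; rewrite ?np //= => _ nl.
rewrite big_ord_recr /= addrC size_polyDl size_scale ?(size_iter_ore_mulX _ nq).1 //.
apply: (leq_ltn_trans (size_sum _ _ _)).
rewrite (@leq_ltn_trans (n + size q).-1) //; last first.
  by rewrite prednK // addn_gt0 size_poly_gt0 nq orbT.
apply/bigmax_leqP => i _; apply: (leq_trans (size_scale_leq _ _)).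
rewrite (size_iter_ore_mulX _ nq).1 -ltnS prednK ?ltn_add2r //.
by rewrite addn_gt0 size_poly_gt0 nq orbT.
Qed.

Lemma ore_division q : q != 0 -> forall p, exists u r,
  p = ore_mul s d u q + r /\ (size r < size q)%N.
Proof.
move=> nq p; have [n] := ubnP (size p); elim: n p => // n IH p /ltnSE le.
have [lt | ge] := ltnP (size p) (size q).
  by exists 0, p; rewrite ore_mul0l add0r.
pose k := (size p - size q)%N; pose t := iter k mulX q.
have [st lt] := size_iter_ore_mulX k nq.
have st' : size t = size p by rewrite st subnK.
have nt : lead_coef t != 0 by rewrite lt iter_fmorph_neq0 ?lead_coef_eq0.
pose c := lead_coef p / lead_coef t.
have np : (0 < size p)%N by apply: leq_trans ge; rewrite size_poly_gt0.
have sm : (size (p - c *: t)%R < n)%N.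
  apply: leq_trans _ le; rewrite -[X in (_ < X)%N](prednK np) ltnS.
  apply/leq_sizeP => j; rewrite leq_eqVlt coefB coefZ => /orP [/eqP <- | lj].
    rewrite -lead_coefE -[in X in _ - _ * X]st' -lead_coefE /c mulfVK ?subrr //.
  rewrite (prednK np) in lj.
  by rewrite !nth_default ?st' // mulr0 subr0.
have [u [r [E sr]]] := IH _ sm.
exists (u + c *: 'X^k), r; split=> //.
rewrite ore_mulDl ore_mulZl addrAC -E.
suff -> : ore_mul s d 'X^k q = t by rewrite addrNK.
rewrite -(ore_mulXn sd) /t; elim: k {sm E IH u c nt st' lt st t} => [|k IHk] /=.
  by rewrite ore_mul1l.
by rewrite (ore_mulXl sd) IHk.
Qed.

Lemma ore_left_ore_domain : left_ore_domain E.
Proof.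
split=> [p q | p q nq].
  move=> E0; have [->|np] := eqVneq (p : {poly F}) 0; first by left.
  have [->|nq] := eqVneq (q : {poly F}) 0; first by right.
  have := size_ore_mul np nq; rewrite [ore_mul _ _ _ _]E0 size_poly0.
  have := size_poly_gt0 p; have := size_poly_gt0 q; rewrite np nq.
  by case: (size p) => // n; case: (size q) => // m _ _; rewrite addnS.
have [n] := ubnP (size (q : {poly F})); elim: n p q nq => // n IH p q nq /ltnSE le.
have [u [r [Ep sr]]] := ore_division nq p.
have [r0 | nr] := eqVneq r 0.
  by exists u, 1; rewrite oner_neq0 mul1r Ep r0 addr0.
have [u' [v' [nv' E']]] := IH q (r : E) nr (leq_trans sr le).
exists (u' * (u : E) + v'), u'.
have Ep' : p = (u : E) * q + r by [].
split; last by rewrite Ep' mulrDr mulrDl mulrA E'.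
have /eqP nvq : v' * q <> 0.
  move=> E0; have := size_ore_mul nv' nq; rewrite [ore_mul _ _ _ _]E0 size_poly0.
  have := size_poly_gt0 (v' : {poly F}); have := size_poly_gt0 (q : {poly F}).
  rewrite nq nv'; case: (size (v' : {poly F})) => // a.
  by case: (size (q : {poly F})) => // b _ _; rewrite addnS.
by apply: contraNneq nvq => u0; rewrite -E' u0 mul0r.
Qed.
End OreField.

Section Operators.
Variable tau : R.

Lemma zero_skew_derivation : skew_derivation (mero_delay tau) (fun _ => 0).
Proof. by split=> a b; rewrite ?mulr0 ?mul0r addr0. Qed.

Definition Kdelta : Type := ore zero_skew_derivation.
HB.instance Definition _ := GRing.NzRing.on Kdelta.

Definition Kdelta_left_ore : left_ore_domain Kdelta :=
  ore_left_ore_domain zero_skew_derivation.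

(* time derivative of the coefficients; the derivative of delta itself is 0
   since delta commutes with d/dt *)
Definition Kdelta_deriv (p : Kdelta) : Kdelta :=
  \poly_(i < size (p : {poly mero})) mero_deriv (p : {poly mero})`_i.

Local Notation mulX := (ore_mulX (mero_delay tau) (fun _ => 0)).

Lemma mero_deriv0 : mero_deriv 0 = 0.
Proof. by apply: (@addrI _ (mero_deriv 0)); rewrite -mero_derivD !addr0. Qed.

Lemma coef_Kdelta_deriv (p : Kdelta) i :
  (Kdelta_deriv p : {poly mero})`_i = mero_deriv (p : {poly mero})`_i.
Proof.
rewrite coef_poly; case: ltnP => // le.
by rewrite nth_default // mero_deriv0.
Qed.

Lemma Kdelta_derivD (p q : Kdelta) :
  Kdelta_deriv (p + q) = Kdelta_deriv p + Kdelta_deriv q.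
Proof.
by apply/polyP => i; rewrite coefD !coef_Kdelta_deriv coefD mero_derivD.
Qed.

Lemma Kdelta_deriv0 : Kdelta_deriv 0 = 0.
Proof. by apply: (@addrI _ (Kdelta_deriv 0)); rewrite -Kdelta_derivD !addr0. Qed.

Lemma Kdelta_derivZ (a : mero) (p : {poly mero}) :
  Kdelta_deriv (a *: p) =
  a *: (Kdelta_deriv p : {poly mero}) + mero_deriv a *: p :> {poly mero}.
Proof.
apply/polyP => i; rewrite coefD !coefZ !coef_Kdelta_deriv coefZ.
exact: mero_derivM.
Qed.

Lemma Kdelta_deriv_mulX (p : {poly mero}) :
  Kdelta_deriv (mulX p) = mulX (Kdelta_deriv p) :> {poly mero}.
Proof.
apply/polyP => i; rewrite coef_Kdelta_deriv.
rewrite !(coef_ore_mulX zero_skew_derivation) !addr0.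
case: i => [|i]; first exact: mero_deriv0.
by rewrite coef_Kdelta_deriv mero_deriv_delay.
Qed.

Lemma Kdelta_deriv_der : skew_derivation idfun Kdelta_deriv.
Proof.
split=> [|p q]; first exact: Kdelta_derivD.
have sz : (size (Kdelta_deriv p : {poly mero}) <= size (p : {poly mero}))%N.
  exact: size_poly.
change (Kdelta_deriv (ore_mul (mero_delay tau) (fun _ => 0) p q) =
  ore_mul (mero_delay tau) (fun _ => 0) p (Kdelta_deriv q) +
  ore_mul (mero_delay tau) (fun _ => 0) (Kdelta_deriv p) q :> {poly mero}).
rewrite (ore_mulE _ _ _ sz) -big_split /=.
rewrite (big_morph Kdelta_deriv Kdelta_derivD Kdelta_deriv0).
apply: eq_bigr => i _; rewrite Kdelta_derivZ coef_Kdelta_deriv.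
congr (_ *: _ + _); elim: (i : nat) => //= j <-.
by rewrite Kdelta_deriv_mulX.
Qed.

Definition Kfrac : Type := lfrac Kdelta_left_ore.
HB.instance Definition _ := GRing.UnitRing.on Kfrac.

Definition Kfrac_of (p : Kdelta) : Kfrac := lfrac_of Kdelta_left_ore p.

Definition Kfrac_deriv : Kfrac -> Kfrac := lfrac_deriv Kdelta_deriv.

Definition Kfrac_deriv_der : skew_derivation idfun Kfrac_deriv :=
  lfrac_deriv_der Kdelta_left_ore Kdelta_deriv_der.

(* K(delta)[d/dt], with coefficients on the left *)
Definition Kop : Type := ore Kfrac_deriv_der.
HB.instance Definition _ := GRing.NzRing.on Kop.

Definition delta : Kdelta := oreX zero_skew_derivation.
Definition Kop_const (c : Kfrac) : Kop := oreC Kfrac_deriv_der c.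
Definition ddt : Kop := oreX Kfrac_deriv_der.
Definition Kop_of (p : Kdelta) : Kop := Kop_const (Kfrac_of p).

Lemma delta_rule (a : mero) :
  delta * oreC zero_skew_derivation a =
  oreC zero_skew_derivation (mero_delay tau a) * delta.
Proof.
have Z : oreC zero_skew_derivation 0 = 0 by exact: polyC0.
by rewrite [LHS]oreX_mulC Z; exact: addr0.
Qed.

Lemma ddt_rule (c : Kfrac) :
  ddt * Kop_const c = Kop_const c * ddt + Kop_const (Kfrac_deriv c).
Proof. exact: oreX_mulC. Qed.

Lemma Kfrac_deriv_of (p : Kdelta) : Kfrac_deriv (Kfrac_of p) = Kfrac_of (Kdelta_deriv p).
Proof. exact: lfrac_deriv_of Kdelta_deriv_der p. Qed.

Lemma delta_ddt : ddt * Kop_of delta = Kop_of delta * ddt.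
Proof.
have Dd : Kdelta_deriv delta = 0.
  apply/polyP => i; rewrite coef_Kdelta_deriv coef0 coefX.
  case: (i == 1)%N; last exact: mero_deriv0.
  exact: (skew_derivation1 (s := idfun) (conj mero_derivD mero_derivM)).
have Z : Kop_const 0 = 0 by exact: polyC0.
by rewrite /Kop_of ddt_rule Kfrac_deriv_of Dd /Kfrac_of rmorph0 Z addr0.
Qed.

(* x lies in the subring K[delta, d/dt] *)
Definition Kop_poly (x : Kop) : Prop :=
  forall i, exists p : Kdelta, (x : {poly Kfrac})`_i = Kfrac_of p.

(* The subring of K(delta)[d/dt] generated by K[delta, d/dt] and pi^-1. As the
   powers of pi need not satisfy the Ore condition, this ring can be larger than
   the set of all x such that pi^s x lies in K[delta, d/dt] for some s. *)
Inductive Kop_loc (pi : Kdelta) : Kop -> Prop :=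
| Kop_loc_poly x : Kop_poly x -> Kop_loc pi x
| Kop_loc_inv : Kop_loc pi (Kop_const (Kfrac_of pi)^-1)
| Kop_loc_add x y : Kop_loc pi x -> Kop_loc pi y -> Kop_loc pi (x + y)
| Kop_loc_mul x y : Kop_loc pi x -> Kop_loc pi y -> Kop_loc pi (x * y).
End Operators.

Section LeftLCM.
Variable R : nzRingType.

Definition left_multiple (a c : R) : Prop := exists u, c = u * a.

Definition is_left_lcm (c : R) (s : seq R) : Prop :=
  (forall a, a \in s -> left_multiple a c) /\
  (forall e, (forall a, a \in s -> left_multiple a e) -> left_multiple c e).
End LeftLCM.

Section SmithJacobson.
Variable E : nzRingType.

Definition unimodular n (U : 'M[E]_n) : Prop :=
  exists V : 'M[E]_n, U *m V = 1%:M /\ V *m U = 1%:M.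

Definition divides (a b : E) : Prop :=
  (exists u, b = a * u) /\ (exists v, b = v * a).

Definition smith_jacobson p q (S : 'M[E]_(p, q)) (U : 'M[E]_p) (V : 'M[E]_q) : Prop :=
  [/\ unimodular U, unimodular V &
   exists (s : nat) (d : nat -> E),
   [/\ (s <= minn p q)%N,
       forall i, (i < s)%N -> d i != 0,
       forall i j, (i <= j < s)%N -> divides (d i) (d j)
     & U *m S *m V = \matrix_(i, j) (if (i == j :> nat) && (i < s)%N then d i else 0)]].

(* [pid_mx (minn p q)] is (I_p | 0) if p <= q, and (I_q ; 0) if p > q *)
Definition hyper_regular_decomp p q (S : 'M[E]_(p, q)) (U : 'M[E]_p) (V : 'M[E]_q) : Prop :=
  [/\ unimodular U, unimodular V & U *m S *m V = pid_mx (minn p q)].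

Definition hyper_regular p q (S : 'M[E]_(p, q)) : Prop :=
  exists U V, hyper_regular_decomp S U V.

(* (0 | I_p) if p <= q, and (0 ; I_q) if p > q *)
Definition rid_mx p q : 'M[E]_(p, q) := \matrix_(i, j) (i + q == j + p)%N%:R.
End SmithJacobson.
Arguments rid_mx {E p q}.

Section Flatness.
Variable tau : R.
Local Notation E := (Kop tau).
Local Notation Kd := (Kdelta tau).

Definition mx_poly p q (S : 'M[E]_(p, q)) : Prop := forall i j, Kop_poly (S i j).

Definition clears (pi : Kd) p q (S : 'M[E]_(p, q)) : Prop := mx_poly (Kop_of pi *: S).

(* M_{p,q}[delta, pi^-1, d/dt] *)
Definition mx_den (pi : Kd) p q (S : 'M[E]_(p, q)) : Prop :=
  exists s : nat, clears (pi ^+ s) S.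

Section System.
Variables (n m : nat) (A : 'M[E]_n) (B : 'M[E]_(n, m)) (pi : Kd).

(* An r-tuple X xi + Y nu of elements of the module on xi_1..xi_n, nu_1..nu_m is
   the matrix (X | Y). Two tuples agree in the system module localized at pi when
   their difference is a combination of the rows of (A | -B) with coefficients in
   the ring K[delta, pi^-1, d/dt]. *)
Definition sys_eq r (w w' : 'M[E]_(r, n + m)) : Prop :=
  exists T : 'M[E]_(r, n),
    (forall i j, Kop_loc pi (T i j)) /\ w - w' = T *m row_mx A (- B).

Definition sys_x : 'M[E]_(n, n + m) := row_mx 1%:M 0.
Definition sys_u : 'M[E]_(m, n + m) := row_mx 0 1%:M.

Definition independent (y : 'M[E]_(m, n + m)) : Prop :=
  forall S : 'M[E]_m, mx_den pi S -> sys_eq (S *m y) 0 -> S = 0.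

Definition flat_output (P0 : 'M[E]_(m, n)) (P1 : 'M[E]_m)
    (Q : 'M[E]_(n, m)) (R : 'M[E]_m) : Prop :=
  let y := P0 *m sys_x + P1 *m sys_u in
  [/\ [/\ mx_den pi P0, mx_den pi P1, mx_den pi Q & mx_den pi R],
      independent y, sys_eq sys_x (Q *m y) & sys_eq sys_u (R *m y)].
End System.

(* The pi-flat output is an operator of x alone: for B hyper-regular, u is
   eliminated and this is pi-flatness of F x = 0. For general B it is more than
   freeness of the localized system module: with n = m = 1, the system
   x = (d/dt) u has the basis y = u, which is no operator of x. *)
Definition pi_flat n m (A : 'M[E]_n) (B : 'M[E]_(n, m)) : Prop :=
  exists (pi : Kd) P Q R, pi != 0 /\ flat_output A B pi P 0 Q R.

(* freeness of the localized system module: y may also involve u *)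
Definition pi_free n m (A : 'M[E]_n) (B : 'M[E]_(n, m)) : Prop :=
  exists (pi : Kd) P0 P1 Q R, pi != 0 /\ flat_output A B pi P0 P1 Q R.
End Flatness.

(* Main.v *)
Require Import Defs.
From Stdlib Require Import Reals.
From mathcomp Require Import all_boot all_algebra.
From mathcomp Require boolp.
From mathcomp Require Import perm zify.
Set Implicit Arguments. Unset Strict Implicit. Unset Printing Implicit Defensive.
Import GRing.Theory.
Local Open Scope ring_scope.

(** K(delta)[d/dt] is a left Euclidean domain, so row reduction brings every left
    invertible matrix to the form (I ; 0). It follows that the ring is stably finite
    and that hyper-regularity is the same as one-sided invertibility.

    Flatness expresses the n + m generators x, u through m operators y modulo the
    rows of (A | -B). Stacking (A | -B) on y then gives a left invertible square
    matrix, whose two-sided inverse contains a right inverse of (A | -B);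
    eliminating u turns it into one of F. If y involves x alone, the equation for u
    also gives a left inverse of B.

    Conversely, Q spans the right kernel of F, and an operator vanishing on Q is a left
    multiple of F. Since P Q = I, this applies to I - Q P and shows x = Q y; the same
    kernel argument gives the independence of y. All coefficients that occur are
    products of the matrices M, N, U, Q~, P, Q and A, so they lie in the localization
    at any common left multiple of the denominators. *)

(** * Complementary blocks of the identity matrix *)

Section Splitting.
Variable E : nzRingType.

Lemma rid_mx_row p q : (rid_mx : 'M[E]_(q, p + q)) = row_mx 0 1%:M.
Proof.
apply/matrixP => i j; rewrite !mxE; case: split_ordP => k ->; rewrite !mxE /=.
  by have -> : (i + (p + q) == k + q)%N = false by have := ltn_ord k; lia.
by rewrite -val_eqE /=; congr (_%:R); congr nat_of_bool; lia.
Qed.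

Lemma rid_mx_col p q : (rid_mx : 'M[E]_(p + q, q)) = col_mx 0 1%:M.
Proof.
apply/matrixP => i j; rewrite !mxE; case: split_ordP => k ->; rewrite !mxE /=.
  by have -> : (k + q == j + (p + q))%N = false by have := ltn_ord k; lia.
by rewrite -val_eqE /=; congr (_%:R); congr nat_of_bool; lia.
Qed.

Variables (p q n : nat).
Hypothesis pqn : (p + q = n)%N.

Lemma pid_mx_pid : (pid_mx p : 'M[E]_(p, n)) *m (pid_mx p : 'M_(n, p)) = 1%:M.
Proof. by subst n; rewrite pid_mx_row pid_mx_col mul_row_col mul1mx mul0mx addr0. Qed.

Lemma rid_mx_rid : (rid_mx : 'M[E]_(q, n)) *m (rid_mx : 'M_(n, q)) = 1%:M.
Proof. by subst n; rewrite rid_mx_row rid_mx_col mul_row_col mul1mx mul0mx add0r. Qed.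

Lemma pid_mx_rid : (pid_mx p : 'M[E]_(p, n)) *m (rid_mx : 'M_(n, q)) = 0.
Proof. by subst n; rewrite pid_mx_row rid_mx_col mul_row_col mulmx0 mul0mx addr0. Qed.

Lemma rid_mx_pid : (rid_mx : 'M[E]_(q, n)) *m (pid_mx p : 'M_(n, p)) = 0.
Proof. by subst n; rewrite rid_mx_row pid_mx_col mul_row_col mulmx0 mul0mx addr0. Qed.

Lemma pid_rid_mx1 : (pid_mx p : 'M[E]_(n, p)) *m (pid_mx p : 'M_(p, n)) +
  (rid_mx : 'M_(n, q)) *m (rid_mx : 'M_(q, n)) = 1%:M.
Proof.
subst n; rewrite pid_mx_col pid_mx_row rid_mx_row rid_mx_col !mul_col_row.
by rewrite !(mul0mx, mulmx0, mulmx1) add_block_mx !(addr0, add0r) -scalar_mx_block.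
Qed.
End Splitting.

(** * Unimodular matrices *)

Section Unimodular.
Variable E : nzRingType.

Lemma unimodular1 n : unimodular (1%:M : 'M[E]_n).
Proof. by exists 1%:M; rewrite mulmx1. Qed.

Lemma unimodularM n (U V : 'M[E]_n) : unimodular U -> unimodular V -> unimodular (U *m V).
Proof.
move=> [U' [UU' U'U]] [V' [VV' V'V]]; exists (V' *m U').
by rewrite !mulmxA -(mulmxA U) VV' mulmx1 UU' -(mulmxA V') U'U mulmx1 V'V.
Qed.

(** The inverse is [1%:M - Z]. Elementary row operations and the shear that normalizes a right
    invertible matrix have this form. *)
Lemma unimodular_nilpotent n (Z : 'M[E]_n) : Z *m Z = 0 -> unimodular (1%:M + Z).
Proof.
move=> ZZ; exists (1%:M - Z).
by rewrite !(mulmxDl, mulmxDr, mulmxN, mulNmx, mul1mx, mulmx1) ZZ oppr0 !addr0 addrNK addrK.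
Qed.

Lemma unimodular_block m n (U : 'M[E]_m) (V : 'M[E]_n) X :
  unimodular U -> unimodular V -> unimodular (block_mx U X 0 V).
Proof.
move=> [U' [UU' U'U]] [V' [VV' V'V]].
exists (block_mx U' (- U' *m X *m V') 0 V').
rewrite !mulmx_block !(mul0mx, mulmx0, addr0, add0r) UU' VV' U'U V'V.
by rewrite !(mulNmx, mulmxN, mulmxA) UU' mul1mx addNr -(mulmxA _ V') V'V mulmx1 subrr -!scalar_mx_block.
Qed.
End Unimodular.

(** * Row reduction over a left Euclidean domain *)

Section LeftEuclidean.
Variables (E : nzRingType) (norm : E -> nat).
Hypothesis division : forall b : E, b != 0 ->
  forall a, exists u r, a = u * b + r /\ (norm r < norm b)%N.
Hypothesis domain : forall a b : E, a * b = 0 -> a = 0 \/ b = 0.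

(** Cancel the nonzero factor [a] in [a * (b * a - 1) = 0]. *)
Lemma domain_mulC1 (a b : E) : a * b = 1 -> b * a = 1.
Proof.
move=> ab; have na : a != 0 by apply/eqP => a0; move/eqP: ab; rewrite a0 mul0r eq_sym oner_eq0.
have [/eqP|/eqP] : a = 0 \/ b * a - 1 = 0.
- by apply: domain; rewrite mulrBr mulrA ab mul1r mulr1 subrr.
- by rewrite (negPf na).
- by rewrite subr_eq0 => /eqP.
Qed.

(** Euclid's algorithm on the entries of a column. Division with the quotient on the left is a row
    operation, and replacing an entry by a remainder lowers the sum of the norms. *)
Lemma column_reduction n (v : 'cV[E]_n.+1) :
  exists U (g : E), unimodular U /\ U *m v = g *: delta_mx 0 0.
Proof.
have [k] := ubnP (\sum_i norm (v i 0%R)); elim: k v => // k IH v /ltnSE le.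
have [/existsP [i /existsP [j /and4P [nij ni nj lij]]]|none] := boolP [exists i, exists j,
   [&& i != j, v i 0 != 0, v j 0 != 0 & (norm (v j 0%R) <= norm (v i 0%R))%N]].
  have [u [r [Ev lt]]] := division nj (v i 0).
  (* Left multiplication by [1%:M + Z] subtracts [u] times row [j] from row [i]. Writing [Z] as a
     column times a row reduces [Z *m Z = 0] to [i != j]. *)
  pose Z := (delta_mx i 0 : 'cV_n.+1) *m (- u *: delta_mx 0 j) : 'M[E]_n.+1.
  have uZ : unimodular (1%:M + Z).
    apply: unimodular_nilpotent; rewrite mulmxA -(mulmxA (delta_mx i 0)) -scalemxAl.
    by rewrite mul_delta_mx_0 1?eq_sym // scaler0 mulmx0 mul0mx.
  have Zv l : ((1%:M + Z) *m v) l 0 = if l == i then r else v l 0.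
    rewrite mulmxDl mul1mx -mulmxA -scalemxAl -rowE mxE.
    rewrite !mxE big_ord1 !mxE eqxx andbT; case: eqP => [->|_]; last by rewrite mul0r addr0.
    by rewrite Ev mul1r mulNr addrAC subrr add0r.
  have [|U [g [uU EU]]] := IH ((1%:M + Z) *m v).
    apply: leq_trans le; rewrite (bigD1 i) //= [X in (_ < X)%N](bigD1 i) //= Zv eqxx.
    rewrite (eq_bigr (fun l => norm (v l 0%R))) => [|l /negPf nl]; last by rewrite Zv nl.
    by rewrite ltn_add2r (leq_trans lt).
  by exists (U *m (1%:M + Z)), g; split; [exact: unimodularM | rewrite -mulmxA].
(* Two nonzero entries are comparable by norm and would allow a reduction. So at most one entry is
   nonzero, and a transposition brings it to the top. *)
have sole i j : i != j -> v i 0 != 0 -> v j 0 = 0.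
  move=> nij ni; apply/eqP; apply: contraNT none => nj.
  wlog le' : i j nij ni nj / (norm (v j 0%R) <= norm (v i 0%R))%N.
    move=> W; have /orP [h|h] := leq_total (norm (v j 0%R)) (norm (v i 0%R)); first exact: (W i j).
    by apply: (W j i) => //; rewrite eq_sym.
  by apply/existsP; exists i; apply/existsP; exists j; apply/and4P.
have [/existsP [i ni]|/existsPn z] := boolP [exists i, v i 0 != 0].
  exists (tperm_mx 0 i), (v i 0); split.
    by exists (tperm_mx 0 i); rewrite -!perm_mxM tperm2 perm_mx1.
  apply/matrixP => a b; rewrite -row_permE !mxE (ord1 b) eqxx andbT.
  case: tpermP => [->|->|/eqP na /eqP ni'].
  - by rewrite eqxx mulr1.
  - have [i0|n0] := eqVneq i 0; first by rewrite mulr1 i0.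
    by rewrite mulr0 (sole i).
  - by rewrite (negPf na) mulr0 (sole i) // eq_sym.
exists 1%:M, 0; split; first exact: unimodular1.
apply/matrixP => a b; rewrite mul1mx scale0r mxE (ord1 b).
by apply/eqP; rewrite -[_ == _]negbK.
Qed.

(** Induction on the number of columns. Once the first column is [(g, 0)], the left inverse of the
    whole matrix inverts [g]; hence its own lower left block vanishes, and its lower right block is
    a left inverse of the remaining matrix. *)
Lemma left_invertible_reduction p q (X : 'M[E]_(q, p)) (Y : 'M_(p, q)) : (p <= q)%N ->
  Y *m X = 1%:M -> exists U, unimodular U /\ U *m X = pid_mx p.
Proof.
elim: p q X Y => [|p IH] [|q] // X Y le YX.
- by exists 1%:M; split; [exact: unimodular1 | apply/matrixP => i []].
- by exists 1%:M; split; [exact: unimodular1 | apply/matrixP => i []].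
suff H (X' : 'M[E]_(1 + q, 1 + p)) (Y' : 'M_(1 + p, 1 + q)) : Y' *m X' = 1%:M ->
    exists U, unimodular U /\ U *m X' = pid_mx (1 + p) by exact: (H X Y).
move=> {X Y YX}; move: X' Y' => X Y YX.
have [U [g [uU EU]]] := column_reduction (lsubmx X).
have [U' [UU' U'U]] := uU.
pose Y' : 'M_(1 + p, 1 + q) := Y *m U'; pose X' : 'M_(1 + q, 1 + p) := U *m X.
have YX' : Y' *m X' = 1%:M by rewrite mulmxA -(mulmxA Y) U'U mulmx1.
have El : lsubmx X' = col_mx g%:M 0.
  rewrite /X' -mulmx_lsub EU; apply/matrixP => i j; rewrite !mxE (ord1 j) eqxx andbT.
  by case: split_ordP => k ->; rewrite !mxE -val_eqE /= ?(ord1 k) ?mulr1 ?mulr0.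
pose x := usubmx (rsubmx X').
have EX : X' = block_mx g%:M x 0 (dsubmx (rsubmx X')).
  by rewrite block_mxEh vsubmxK -El hsubmxK.
move: YX'; rewrite EX -[Y']submxK mulmx_block scalar_mx_block => /eq_block_mx [].
rewrite !(mulmx0, addr0) => yg _ y'g YX'.
have gy : g * (ulsubmx Y' 0 0) = 1.
  apply: domain_mulC1; have /matrixP /(_ 0 0) := yg.
  by rewrite !mxE big_ord1 !mxE eqxx !mulr1n.
have y'0 : dlsubmx Y' = 0.
  apply/matrixP => i j; have /matrixP /(_ i 0) := y'g; rewrite !mxE big_ord1 !mxE (ord1 j) eqxx mulr1n.
  by move/(congr1 (fun z => z * ulsubmx Y' 0 0)); rewrite -mulrA gy mulr1 mul0r.
rewrite y'0 mul0mx add0r in YX'.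
have [V [uV EV]] := IH _ _ _ (le : p <= q)%N YX'.
have uy : unimodular (ulsubmx Y').
  exists g%:M; split=> //.
  by apply/matrixP => i j; rewrite mul_scalar_mx mxE (ord1 i) (ord1 j) gy mxE.
(* The lower block is already [pid_mx p], so its rows clear the entries [ulsubmx Y' *m x] to the
   right of the pivot. *)
pose Z : 'M_(1 + q) := block_mx 1%:M (- (ulsubmx Y' *m x *m pid_mx p)) 0 1%:M.
exists (Z *m block_mx (ulsubmx Y') 0 0 V *m U); split.
  apply: unimodularM => //; apply: unimodularM; apply: unimodular_block => //; exact: unimodular1.
have -> : Z *m block_mx (ulsubmx Y') 0 0 V *m U *m X = Z *m (block_mx (ulsubmx Y') 0 0 V *m X').
  by rewrite !mulmxA.
rewrite EX !mulmx_block.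
rewrite !(mul0mx, mulmx0, mul1mx, addr0, add0r) yg EV.
rewrite mulNmx -(mulmxA _ (pid_mx p)) pid_mx_id // pid_mx_1 mulmx1 subrr.
apply/matrixP => i j; rewrite [RHS]mxE.
case: (split_ordP i) => k ->; case: (split_ordP j) => l ->.
- by rewrite block_mxEul mxE !ord1.
- by rewrite block_mxEur mxE !ord1.
- by rewrite block_mxEdl mxE !ord1.
- by rewrite block_mxEdr mxE.
Qed.

(** Stable finiteness: in the square case the reduced form is the identity, so [X] is the inverse of
    a unimodular matrix. *)
Lemma mulmx1C_eq p q (X : 'M[E]_(q, p)) (Y : 'M_(p, q)) : p = q ->
  Y *m X = 1%:M -> X *m Y = 1%:M.
Proof.
move=> pq; subst q => YX.
have [U [[U' [UU' U'U]] UX]] := left_invertible_reduction (leqnn p) YX.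
rewrite pid_mx_1 in UX.
have EX : X = U' by rewrite -[LHS]mul1mx -U'U -mulmxA UX mulmx1.
rewrite {}EX in YX *.
by have -> : Y = U by rewrite -[LHS]mulmx1 -U'U mulmxA YX mul1mx.
Qed.

Lemma hyper_regularP_left p q (S : 'M[E]_(p, q)) : (q <= p)%N ->
  hyper_regular S <-> exists X, X *m S = 1%:M.
Proof.
move=> le; rewrite /hyper_regular /hyper_regular_decomp (minn_idPr le).
split=> [[U [V [_ [V' [VV' V'V]] EUV]]] | [X XS]].
  exists (V *m pid_mx q *m U).
  have US : U *m S = pid_mx q *m V' by rewrite -EUV -mulmxA VV' mulmx1.
  by rewrite -mulmxA US mulmxA -(mulmxA V) pid_mx_id // pid_mx_1 mulmx1.
have [U [uU EU]] := left_invertible_reduction le XS.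
by exists U, 1%:M; split; rewrite ?mulmx1 //; exact: unimodular1.
Qed.

(** Division is available on one side only, so [S] is not reduced by columns. Instead the rows of
    its right inverse are reduced to [pid_mx p], after which the first [p] columns of [S'] form the
    identity. *)
Lemma hyper_regularP_right p q (S : 'M[E]_(p, q)) : (p <= q)%N ->
  hyper_regular S <-> exists X, S *m X = 1%:M.
Proof.
move=> le; rewrite /hyper_regular /hyper_regular_decomp (minn_idPl le).
have pp : (pid_mx p : 'M[E]_(p, q)) *m (pid_mx p : 'M_(q, p)) = 1%:M.
  by rewrite pid_mx_id // pid_mx_1.
split=> [[U [V [[U' [UU' U'U]] _ EUV]]] | [X SX]].
  exists (V *m pid_mx p *m U).
  have SV : S *m V = U' *m pid_mx p by rewrite -EUV !mulmxA U'U mul1mx.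
  by rewrite !mulmxA SV -(mulmxA U') pp mulmx1 U'U.
have [U [[U' [UU' U'U]] EU]] := left_invertible_reduction le SX.
pose S' := S *m U'.
have S'p : S' *m pid_mx p = 1%:M by rewrite -EU mulmxA -(mulmxA S) U'U mulmx1.
(* Right multiplication by [1%:M + Z] clears the other columns of [S']. [Z] squares to zero because
   [pid_mx p] and [S'] agree on the first [p] columns. *)
pose Z : 'M_q := pid_mx p *m (pid_mx p - S').
have S'Z : S' *m Z = pid_mx p - S' by rewrite mulmxA S'p mul1mx.
exists 1%:M, (U' *m (1%:M + Z)); split.
- exact: unimodular1.
- apply: unimodularM; first by exists U.
  apply: unimodular_nilpotent; rewrite /Z -mulmxA (mulmxA _ (pid_mx p)).
  by rewrite mulmxBl pp S'p subrr mul0mx mulmx0.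
- by rewrite mul1mx mulmxA -/S' mulmxDr mulmx1 S'Z addrC subrK.
Qed.

(** * Right inverses before and after elimination of the input *)

Section System.
Variables (n m : nat) (A : 'M[E]_n) (B : 'M[E]_(n, m)).
Hypothesis le_mn : (m <= n)%N.
Local Notation row_top := (pid_mx m : 'M[E]_(m, n)).
Local Notation col_top := (pid_mx m : 'M[E]_(n, m)).
Local Notation row_bot := (rid_mx : 'M[E]_(n - m, n)).
Local Notation col_bot := (rid_mx : 'M[E]_(n, n - m)).

(* The module on x, u modulo A x = B u has rank at least m, so m generators are a
   basis and the relation module is a direct summand: stacking the relations on
   top of the m operators y gives a square matrix with a left inverse. *)
Lemma generated_right_invertible (Y : 'M_(m, n + m)) (G : 'M_(n + m, m)) (T : 'M_(n + m, n)) :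
  1%:M - G *m Y = T *m row_mx A (- B) ->
  exists X, row_mx A (- B) *m X = 1%:M.
Proof.
move=> E1; have : row_mx T G *m col_mx (row_mx A (- B)) Y = 1%:M.
  by rewrite mul_row_col -E1 subrK.
move/(mulmx1C_eq (erefl (n + m)%N)); rewrite mul_col_row scalar_mx_block.
by case/eq_block_mx => ET _ _ _; exists T.
Qed.

(** Multiplying [A *m X1 - B *m X2 = 1%:M] on the left by [row_bot *m M], which kills [B], removes
    [X2]; that multiplier itself has the right inverse [M' *m col_bot]. *)
Lemma eliminated_right_invertible (M : 'M_n) : unimodular M -> row_bot *m M *m B = 0 ->
  (exists X, row_mx A (- B) *m X = 1%:M) -> exists X, row_bot *m M *m A *m X = 1%:M.
Proof.
move=> [M' [MM' M'M]] MB [X].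
rewrite -[X]vsubmxK mul_row_col; set X1 := usubmx X; set X2 := dsubmx X => EX.
exists (X1 *m M' *m col_bot).
have -> : row_bot *m M *m A *m (X1 *m M' *m col_bot) =
    row_bot *m M *m (A *m X1 + - B *m X2) *m M' *m col_bot.
  by rewrite mulmxDr mulNmx mulmxN !mulmxA MB mul0mx subr0.
by rewrite EX mulmx1 -(mulmxA _ M) MM' mulmx1 (rid_mx_rid _ (subnKC le_mn)).
Qed.

(** A converse for left invertible [B]: the two lemmas together carry right invertibility of the
    eliminated system from one choice of [M] to another. *)
Lemma system_right_invertible (M : 'M_n) : unimodular M -> row_bot *m M *m B = 0 ->
  (exists L, L *m B = 1%:M) -> (exists X, row_bot *m M *m A *m X = 1%:M) ->
  exists X, row_mx A (- B) *m X = 1%:M.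
Proof.
have split1 := pid_rid_mx1 E (subnKC le_mn).
move=> [M' [MM' M'M]] MB [L LB] [X FX].
pose C := row_top *m M *m B.
have MBE : M *m B = col_top *m C.
  rewrite -[M *m B]mul1mx -split1 mulmxDl -(mulmxA col_bot) (mulmxA row_bot) MB mulmx0 addr0.
  by rewrite /C !mulmxA.
(* [C] is square and has this left inverse because [L *m B = 1%:M]; stable finiteness makes it
   two-sided. *)
have CL : C *m (L *m M' *m col_top) = 1%:M.
  by apply: mulmx1C_eq => //; rewrite -!mulmxA -MBE (mulmxA M') M'M mul1mx.
(* [Y] solves the lower equations; [Z] then solves the upper ones through the inverse of [C]. *)
pose Y := X *m row_bot; pose Z := L *m M' *m col_top *m (row_top *m M *m A *m Y - row_top).
exists (col_mx Y Z *m M).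
suff EM : M *m (row_mx A (- B) *m col_mx Y Z) = 1%:M.
  by rewrite mulmxA -[X in X *m M]mul1mx -M'M -(mulmxA M') EM mulmx1.
have CZ : C *m Z = row_top *m M *m A *m Y - row_top by rewrite mulmxA CL mul1mx.
rewrite mul_row_col mulmxDr mulNmx mulmxN (mulmxA M A) (mulmxA M B) MBE -(mulmxA _ C) CZ.
have -> : M *m A *m Y = col_top *m (row_top *m M *m A *m Y) + col_bot *m row_bot.
  rewrite -[LHS]mul1mx -split1 mulmxDl -!mulmxA; congr (_ + _); congr (_ *m _).
  by rewrite /Y !mulmxA FX mul1mx.
by rewrite mulmxBr opprB addrC addrA subrK.
Qed.
End System.
End LeftEuclidean.

(** * Degree and division for skew polynomials over a division ring *)

Section OreDivisionRing.
Variables (R : unitRingType) (s : {rmorphism R -> R}) (d : R -> R).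
Hypothesis sd : skew_derivation s d.
Hypothesis nz_unit : forall x : R, x != 0 -> x \is a GRing.unit.
Local Notation E := (ore sd).
Local Notation mulX := (ore_mulX s d).
Implicit Types p q r : {poly R}.

Lemma divring_rmorph_neq0 (a : R) : a != 0 -> s a != 0.
Proof.
move=> na; apply/eqP => E0; have /eqP : s (a^-1 * a) = 1 by rewrite mulVr ?rmorph1 ?nz_unit.
by rewrite rmorphM /= E0 mulr0 eq_sym oner_eq0.
Qed.

(** Each multiplication by the variable applies [s] to the leading coefficient, which stays nonzero
    because [s] is injective on a division ring. *)
Lemma divring_size_iter_mulX i q : q != 0 -> size (iter i mulX q) = (i + size q)%N.
Proof.
move=> nq; elim: i => //= i; set t := iter i mulX q => IH.
apply/eqP; rewrite addSn -IH eqn_leq size_poly /= ltnNge; apply/negP => le.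
have : lead_coef t != 0.
  by rewrite lead_coef_eq0 -size_poly_gt0 IH addn_gt0 size_poly_gt0 nq orbT.
move/divring_rmorph_neq0/negP; apply.
have tpos : (0 < size t)%N by rewrite IH addn_gt0 size_poly_gt0 nq orbT.
have := nth_default 0 le; rewrite (coef_ore_mulX sd) (nth_default 0 (leqnn _)).
by rewrite (skew_derivation0 sd) addr0 lead_coefE; case: (size t) tpos => //= k _ ->.
Qed.

Lemma divring_size_scale (a : R) p : a != 0 -> size (a *: p) = size p.
Proof.
move=> na; apply/eqP; rewrite eqn_leq size_scale_leq.
by rewrite -{1}[p]scale1r -(mulVr (nz_unit na)) -scalerA size_scale_leq.
Qed.

Lemma divring_size_ore_mul p q : p != 0 -> q != 0 ->
  size (ore_mul s d p q) = (size p + size q).-1.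
Proof.
move=> np nq; rewrite /ore_mul; have : lead_coef p != 0 by rewrite lead_coef_eq0.
have qpos : (0 < size q)%N by rewrite size_poly_gt0.
rewrite lead_coefE; case: (size p) (size_poly_gt0 p) => [|n]; rewrite ?np //= => _ nl.
have sn := divring_size_scale (iter n mulX q) nl.
rewrite divring_size_iter_mulX // in sn.
rewrite big_ord_recr /= addrC size_polyDl sn //.
apply: (leq_ltn_trans (size_sum _ _ _)); rewrite (@leq_ltn_trans (n + size q).-1) //; last by lia.
apply/bigmax_leqP => i _; apply: (leq_trans (size_scale_leq _ _)).
by rewrite divring_size_iter_mulX //; have := ltn_ord i; lia.
Qed.

Lemma ore_divring_domain (a b : E) : a * b = 0 -> a = 0 \/ b = 0.
Proof.
move=> E0; have [->|na] := eqVneq (a : {poly R}) 0; first by left.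
have [->|nb] := eqVneq (b : {poly R}) 0; first by right.
have := divring_size_ore_mul na nb; rewrite [ore_mul _ _ _ _]E0 size_poly0.
have : (0 < size (a : {poly R}))%N by rewrite size_poly_gt0.
have : (0 < size (b : {poly R}))%N by rewrite size_poly_gt0.
by lia.
Qed.

Lemma ore_divring_division (b : E) : b != 0 ->
  forall a : E, exists u r : E, a = u * b + r /\ (size (r : {poly R}) < size (b : {poly R}))%N.
Proof.
move=> nb a; have [n] := ubnP (size (a : {poly R})); elim: n a => // n IH a /ltnSE le.
have [lt | ge] := ltnP (size (a : {poly R})) (size (b : {poly R})).
  by exists 0, a; rewrite mul0r add0r.
pose k := (size (a : {poly R}) - size (b : {poly R}))%N; pose t := iter k mulX b.
have st : size t = size (a : {poly R}) by rewrite divring_size_iter_mulX // subnK.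
have bpos : (0 < size (b : {poly R}))%N by rewrite size_poly_gt0.
have nt : lead_coef t \is a GRing.unit.
  by apply: nz_unit; rewrite lead_coef_eq0 -size_poly_gt0 st; lia.
(* Coefficients stand on the left, so [c *: t] is a left multiple of [b] with the leading term of
   [a]. *)
pose c := lead_coef (a : {poly R}) / lead_coef t.
have sm : (size ((a : {poly R}) - c *: t)%R < n)%N.
  have apos : (0 < size (a : {poly R}))%N := leq_trans bpos ge.
  apply: leq_trans _ le; rewrite -[X in (_ < X)%N](prednK apos) ltnS.
  apply/leq_sizeP => j; rewrite leq_eqVlt coefB coefZ => /orP [/eqP <- | lj].
    by rewrite -lead_coefE -[in X in _ - _ * X]st -lead_coefE /c mulrVK ?subrr.
  by rewrite (prednK apos) in lj; rewrite !nth_default ?st ?mulr0 ?subr0.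
have [u [r [Er sr]]] := IH _ sm.
exists (u + c *: ('X^k : {poly R})), r; split=> //.
have -> : (u + c *: ('X^k : {poly R}) : E) * b = u * b + c *: t.
  rewrite [LHS](ore_mulDl s d) ore_mulZl; congr (_ + c *: _).
  rewrite -(ore_mulXn sd) /t; elim: (k) => [|l IHl] /=; first by rewrite ore_mul1l.
  by rewrite (ore_mulXl sd) IHl.
by rewrite addrAC -Er addrNK.
Qed.
End OreDivisionRing.

(** * Common left multiples *)

Section LeftMultiples.
Variable R : nzRingType.
Hypothesis ore_R : left_ore_domain R.

Lemma left_multiple_mul (u a c : R) : left_multiple a c -> left_multiple a (u * c).
Proof. by case=> v ->; exists (u * v); rewrite mulrA. Qed.

Lemma left_multiple_trans (a b c : R) : left_multiple a b -> left_multiple b c -> left_multiple a c.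
Proof. by move=> ab [u ->]; exact: left_multiple_mul. Qed.

(** Stated for any predicate stable under left multiplication, so that one induction serves ring
    elements, coefficients of an operator and entries of a matrix. The Ore condition merges two
    multiples. *)
Lemma common_left_multiple (T : eqType) (P : R -> T -> Prop) (xs : seq T) :
  (forall u c x, P c x -> P (u * c) x) ->
  (forall x, x \in xs -> exists2 c, c != 0 & P c x) ->
  exists2 c, c != 0 & forall x, x \in xs -> P c x.
Proof.
move=> Pmul; elim: xs => [|x xs IH] Pxs; first by exists 1; rewrite ?oner_neq0.
have [|a na Pa] := IH; first by move=> y yxs; apply: Pxs; rewrite inE yxs orbT.
have [b nb Pb] := Pxs x (mem_head _ _).
have [u [v [nv Euv]]] := ore_R.2 a b nb.
exists (v * a) => [|y]; first by apply/eqP => /ore_R.1 [] /eqP; apply/negP.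
by rewrite inE => /predU1P [-> | yxs]; [rewrite -Euv; exact: Pmul | apply: Pmul; exact: Pa].
Qed.

(** The Ore condition supplies a nonzero common left multiple, and this is a left multiple of
    [c]. *)
Lemma left_lcm_neq0 (c : R) (s : seq R) : is_left_lcm c s ->
  (forall a, a \in s -> a != 0) -> c != 0.
Proof.
move=> [_ minc] ns.
have [e ne eP] := @common_left_multiple _ (fun e a => left_multiple a e) s
  (fun u e a => @left_multiple_mul u a e) (fun a sa => ex_intro2 _ _ a (ns a sa)
    (ex_intro _ 1 (esym (mul1r a)))).
have [u Eu] := minc e eP.
by apply: contraNneq ne => c0; rewrite Eu c0 mulr0.
Qed.

(** Take a nonzero common left multiple of least norm. The remainder of any other one modulo it is
    again a common left multiple, hence zero. *)
Lemma left_lcm_exists (norm : R -> nat) (s : seq R) :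
  (forall b : R, b != 0 -> forall a, exists u r, a = u * b + r /\ (norm r < norm b)%N) ->
  exists c, is_left_lcm c s.
Proof.
move=> division; pose I c := forall a, a \in s -> left_multiple a c.
have [[e [ne Ie]]|none] := boolp.pselect (exists e, e != 0 /\ I e); last first.
  (* If 0 is the only common left multiple, it is the LCM. *)
  exists 0; split=> [a _|e Ie]; first by exists 0; rewrite mul0r.
  exists 0; rewrite mul0r; apply/eqP; apply: boolp.contrapT => /negP ne.
  by apply: none; exists e.
have [n] := ubnP (norm e); elim: n e ne Ie => // n IH e ne Ie /ltnSE le.
have [[r [nr Ir lt]]|none] := boolp.pselect (exists r, [/\ r != 0, I r & (norm r < norm e)%N]).
  exact: (IH r nr Ir (leq_trans lt le)).
exists e; split=> // f If; have [u [r [Ef lt]]] := division e ne f.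
exists u; rewrite Ef; have [->|nr] := eqVneq r 0; first by rewrite addr0.
case: none; exists r; split=> // a sa.
have [x Ex] := Ie a sa; have [y Ey] := If a sa; exists (y - u * x).
by rewrite mulrBl -Ey -mulrA -Ex Ef addrAC subrr add0r.
Qed.
End LeftMultiples.

(** * Clearing denominators in K(delta)[d/dt] *)

Section Operators.
Variable tau : R.
Local Notation E := (Kop tau).
Local Notation Kd := (Kdelta tau).
Local Notation fr := (@Kfrac_of tau).
Local Notation coefs x := (x : {poly Kfrac tau}).

Lemma Kop_domain (a b : E) : a * b = 0 -> a = 0 \/ b = 0.
Proof.
apply: (@ore_divring_domain _ _ _ (Kfrac_deriv_der tau)) => x nx.
by rewrite lfrac_unitE.
Qed.

Definition Kop_norm (x : E) : nat := size (coefs x).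

Lemma Kop_division (b : E) : b != 0 ->
  forall a, exists u r, a = u * b + r /\ (Kop_norm r < Kop_norm b)%N.
Proof.
apply: (@ore_divring_division _ _ _ (Kfrac_deriv_der tau)) => x nx.
by rewrite lfrac_unitE.
Qed.

Lemma Kdelta_division (b : Kd) : b != 0 -> forall a, exists u r : Kd,
  a = u * b + r /\ (size (r : {poly mero}) < size (b : {poly mero}))%N.
Proof. by move=> nb a; exact: (ore_division (zero_skew_derivation tau) nb a). Qed.

Lemma Kdelta_lcm_exists (s : seq Kd) : exists c, is_left_lcm c s.
Proof. exact: left_lcm_exists Kdelta_division. Qed.

Lemma coef_Kop_const_mul (c : Kfrac tau) (x : E) i : (coefs (Kop_const c * x))`_i = c * (coefs x)`_i.
Proof.
change ((ore_mul idfun (@Kfrac_deriv tau) c%:P (coefs x))`_i = c * (coefs x)`_i).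
by rewrite -alg_polyC ore_mulZl ore_mul1l coefZ.
Qed.

Lemma coef_Kop_of_mul (p : Kd) (x : E) i : (coefs (Kop_of p * x))`_i = fr p * (coefs x)`_i.
Proof. exact: coef_Kop_const_mul. Qed.

Lemma Kfrac_of_neq0 (p : Kd) : p != 0 -> fr p != 0.
Proof.
move=> np; apply: contraNneq np => E0; apply/eqP.
by apply: (@lfrac_of_inj _ (Kdelta_left_ore tau)); rewrite [LHS]E0 rmorph0.
Qed.

Lemma Kop_poly_nat n : Kop_poly (n%:R : E).
Proof.
move=> i; exists (if i == 0%N then n%:R else 0).
have -> : (n%:R : E) = (n%:R : {poly Kfrac tau}) :> {poly _} by elim: n => // n IH; rewrite !mulrS IH.
rewrite -polyC_natr coefC; case: eqP => _; last by rewrite /Kfrac_of rmorph0.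
by rewrite /Kfrac_of rmorph_nat.
Qed.

Lemma Kop_polyD (x y : E) : Kop_poly x -> Kop_poly y -> Kop_poly (x + y).
Proof.
move=> px py i; have [p Ep] := px i; have [q Eq] := py i; exists (p + q).
by rewrite [LHS]coefD Ep Eq /Kfrac_of rmorphD.
Qed.

Lemma Kop_polyN (x : E) : Kop_poly x -> Kop_poly (- x).
Proof.
by move=> px i; have [p Ep] := px i; exists (- p); rewrite [LHS]coefN Ep /Kfrac_of rmorphN.
Qed.

(** Left multiplication by [Kop_of c] acts coefficientwise, so a common left multiple of the
    finitely many denominators works. *)
Lemma Kop_poly_denominator (x : E) : exists2 c : Kd, c != 0 & Kop_poly (Kop_of c * x).
Proof.
have [||c nc cP] := @common_left_multiple _ (Kdelta_left_ore tau) _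
    (fun c z => exists p, fr c * z = fr p) (coefs x).
- by move=> u c z [p Ep]; exists (u * p); rewrite /Kfrac_of !rmorphM /= -mulrA; congr (_ * _).
- by move=> z _; have [v [u [nv Euv]]] := lfracP z; exists v => //; exists u.
exists c => // i; rewrite coef_Kop_of_mul.
have [lt|ge] := ltnP i (size (coefs x)); first by apply: cP; exact: mem_nth.
by exists 0; rewrite nth_default // mulr0 /Kfrac_of rmorph0.
Qed.

Lemma Kop_poly_denominator_mul (u c : Kd) (x : E) :
  Kop_poly (Kop_of c * x) -> Kop_poly (Kop_of (u * c) * x).
Proof.
move=> px i; have [p Ep] := px i; exists (u * p).
rewrite !coef_Kop_of_mul in Ep *.
by rewrite /Kfrac_of !rmorphM /= -mulrA; congr (_ * _).
Qed.

Lemma clears_multiple (a c : Kd) p q (S : 'M[E]_(p, q)) :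
  left_multiple a c -> clears a S -> clears c S.
Proof.
move=> [u ->] aS i j; rewrite mxE; apply: Kop_poly_denominator_mul.
by have := aS i j; rewrite mxE.
Qed.

Lemma clears_exists p q (S : 'M[E]_(p, q)) : exists2 c : Kd, c != 0 & clears c S.
Proof.
have [||c nc cP] := @common_left_multiple _ (Kdelta_left_ore tau) _
    (fun c (ij : 'I_p * 'I_q) => Kop_poly (Kop_of c * S ij.1 ij.2)) (enum {: 'I_p * 'I_q}).
- by move=> u c ij; exact: Kop_poly_denominator_mul.
- by move=> ij _; exact: Kop_poly_denominator.
by exists c => // i j; rewrite mxE; apply: (cP (i, j)); rewrite mem_enum.
Qed.

Lemma clears2_exists p q p' q' (S : 'M[E]_(p, q)) (S' : 'M[E]_(p', q')) :
  exists c : Kd, [/\ c != 0, clears c S & clears c S'].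
Proof.
have [a na aS] := clears_exists S; have [b nb bS'] := clears_exists S'.
have [c lcm] := Kdelta_lcm_exists [:: a; b]; exists c; split.
- by apply: left_lcm_neq0 lcm _ => [|e]; [exact: Kdelta_left_ore | rewrite !inE => /orP [] /eqP ->].
- by apply: clears_multiple aS; apply: lcm.1; rewrite !inE eqxx.
- by apply: clears_multiple bS'; apply: lcm.1; rewrite !inE eqxx orbT.
Qed.

Lemma clears_mx_den (c : Kd) p q (S : 'M[E]_(p, q)) : clears c S -> mx_den c S.
Proof. by exists 1%N; rewrite expr1. Qed.

Lemma mx_den0 (c : Kd) p q : mx_den c (0 : 'M[E]_(p, q)).
Proof. by exists 0%N => i j; rewrite scaler0 mxE; exact: (Kop_poly_nat 0). Qed.

Lemma clears_mul_rid (c : Kd) p q r (S : 'M[E]_(p, q)) :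
  clears c S -> clears c (S *m (rid_mx : 'M_(q, r))).
Proof.
move=> cS i j; rewrite /clears scalemxAl mxE; apply: (big_ind (@Kop_poly tau)).
- exact: (Kop_poly_nat 0).
- exact: Kop_polyD.
- move=> k _; rewrite [X in _ * X]mxE mulr_natr.
  by case: (_ == _); [rewrite mulr1n; exact: cS | rewrite mulr0n; exact: (Kop_poly_nat 0)].
Qed.

(** * Matrices over the localized ring *)

Section Localization.
Variable c : Kd.
Hypothesis nc : c != 0.

(** Unlike [clears c], this is stable under products, as needed for the coefficient matrices in
    [sys_eq]. *)
Definition mx_loc p q (S : 'M[E]_(p, q)) : Prop := forall i j, Kop_loc c (S i j).

Lemma mx_loc_poly p q (S : 'M[E]_(p, q)) : mx_poly S -> mx_loc S.
Proof. by move=> pS i j; apply: Kop_loc_poly. Qed.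

Lemma mx_loc_clears p q (S : 'M[E]_(p, q)) : clears c S -> mx_loc S.
Proof.
move=> cS i j; have -> : S i j = Kop_const (fr c)^-1 * (Kop_of c * S i j).
  apply/polyP => k; rewrite coef_Kop_const_mul coef_Kop_of_mul.
  by rewrite mulKr // lfrac_unitE; exact: Kfrac_of_neq0.
apply: Kop_loc_mul; first exact: Kop_loc_inv.
by apply: Kop_loc_poly; have := cS i j; rewrite mxE.
Qed.

Lemma mx_locD p q (S S' : 'M[E]_(p, q)) : mx_loc S -> mx_loc S' -> mx_loc (S + S').
Proof. by move=> lS lS' i j; rewrite mxE; exact: Kop_loc_add. Qed.

Lemma mx_locM p q r (S : 'M[E]_(p, q)) (S' : 'M[E]_(q, r)) :
  mx_loc S -> mx_loc S' -> mx_loc (S *m S').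
Proof.
move=> lS lS' i j; rewrite mxE; apply: (big_ind (Kop_loc c)).
- by apply: Kop_loc_poly; exact: (Kop_poly_nat 0).
- exact: Kop_loc_add.
- by move=> k _; exact: Kop_loc_mul.
Qed.

Lemma mx_locN p q (S : 'M[E]_(p, q)) : mx_loc S -> mx_loc (- S).
Proof.
move=> lS i j; rewrite mxE -mulN1r; apply: Kop_loc_mul => //; apply: Kop_loc_poly.
by apply: Kop_polyN; exact: (Kop_poly_nat 1).
Qed.

Lemma mx_loc1 p : mx_loc (1%:M : 'M[E]_p).
Proof.
by apply: mx_loc_poly => i j; rewrite mxE; exact: Kop_poly_nat.
Qed.

Lemma mx_loc_pid p q r : mx_loc (pid_mx r : 'M[E]_(p, q)).
Proof. by apply: mx_loc_poly => i j; rewrite mxE; exact: Kop_poly_nat. Qed.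

Lemma mx_loc_rid p q : mx_loc (rid_mx : 'M[E]_(p, q)).
Proof. by apply: mx_loc_poly => i j; rewrite mxE; exact: Kop_poly_nat. Qed.
End Localization.
End Operators.

(** * Consequences of flatness, and the elimination of the input *)

Section FlatOutputs.
Variables (tau : R) (n m : nat).
Local Notation E := (Kop tau).
Local Notation Kd := (Kdelta tau).
Hypothesis le_mn : (m <= n)%N.
Variables (A : 'M[E]_n) (B : 'M[E]_(n, m)).

(** Stacked, the congruences for x and u say that the identity minus [col_mx Q S *m Y] is a left
    multiple of the relations. *)
Lemma pi_free_right_invertible : pi_free A B -> exists X, row_mx A (- B) *m X = 1%:M.
Proof.
move=> [c [P0 [P1 [Q [S [_ [_ _ [T1 [_ E1]] [T2 [_ E2]]]]]]]]].
pose Y := P0 *m @sys_x tau n m + P1 *m @sys_u tau n m.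
apply: (@generated_right_invertible _ _ (@Kop_division tau) (@Kop_domain tau) n m A B
  Y (col_mx Q S) (col_mx T1 T2)).
by rewrite !mul_col_mx -E1 -E2 -/Y scalar_mx_block -add_col_mx opp_col_mx.
Qed.

(** Since y does not involve u, the u-columns of the congruence for u read [1%:M = - (T *m B)]. *)
Lemma pi_flat_left_invertible : pi_flat A B -> exists X, X *m B = 1%:M.
Proof.
move=> [c [P [Q [S [_ [_ _ _ [T [_ ET]]]]]]]]; exists (- T).
move: ET; rewrite mul0mx addr0 /sys_x /sys_u !mul_mx_row !mulmx0 mulmx1 opp_row_mx add_row_mx.
by rewrite oppr0 addr0 mulmxN -mulNmx => /eq_row_mx [_ <-].
Qed.

Local Notation row_top := (pid_mx m : 'M[E]_(m, n)).
Local Notation col_top := (pid_mx m : 'M[E]_(n, m)).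
Local Notation row_bot := (rid_mx : 'M[E]_(n - m, n)).
Local Notation col_bot := (rid_mx : 'M[E]_(n, n - m)).

Lemma smith_jacobson_eliminates (M : 'M_n) (N : 'M_m) :
  smith_jacobson B M N -> row_bot *m M *m B = 0.
Proof.
move=> [_ [N' [NN' _]] [s [d [sm _ _ EMBN]]]].
suff z : row_bot *m (M *m B *m N) = 0.
  have -> : row_bot *m M *m B = row_bot *m (M *m B *m N) *m N' by rewrite -!mulmxA NN' mulmx1.
  by rewrite z mul0mx.
rewrite EMBN; apply/matrixP => i j; rewrite mxE big1 ?mxE // => k _; rewrite !mxE.
(* Row [i] of [rid_mx] selects [k = i + m], whereas a nonzero diagonal entry has [k = j < m]. *)
case: eqP => [ik|_]; last by rewrite mul0r.
by case: ifP => [/andP [/eqP kj _]|_]; [have := ltn_ord j; lia | rewrite mulr0].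
Qed.

Lemma decomp_eliminates (M : 'M_n) (N : 'M_m) :
  hyper_regular_decomp B M N -> row_bot *m M *m B = 0.
Proof.
move=> [_ [N' [NN' _]]]; rewrite (minn_idPr le_mn) => EMBN.
have MB : M *m B = col_top *m N' by rewrite -EMBN -(mulmxA _ N) NN' mulmx1.
by rewrite -mulmxA MB mulmxA (rid_mx_pid _ (subnKC le_mn)) mul0mx.
Qed.

(** [F] splits [n] as [(n - m) + m], while [B] splits it as [m + (n - m)]; hence a second set of
    blocks. *)
Local Notation row_topF := (pid_mx (n - m) : 'M[E]_(n - m, n)).
Local Notation col_topF := (pid_mx (n - m) : 'M[E]_(n, n - m)).
Local Notation row_botF := (rid_mx : 'M[E]_(m, n)).
Local Notation col_botF := (rid_mx : 'M[E]_(n, m)).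

(** * The constructed operators form a flat output *)

Section Construction.
Variables (M : 'M[E]_n) (N : 'M[E]_m) (U : 'M[E]_(n - m)) (Qt : 'M[E]_n).
Hypothesis MBN : hyper_regular_decomp B M N.
Hypothesis UFQ : hyper_regular_decomp (row_bot *m M *m A) U Qt.
Let F := row_bot *m M *m A.
Let Q := Qt *m col_botF.

(** [Q] consists of the last [m] columns of [Qt], where the reduced form of [F] vanishes. *)
Lemma F_Q_eq0 : F *m Q = 0.
Proof.
case: UFQ => [[U' [_ U'U]] _]; rewrite (minn_idPl (leq_subr m n)) -/F => EF.
rewrite -[LHS]mul1mx -U'U -(mulmxA U') (mulmxA U F) (mulmxA (U *m F) Qt) EF.
by rewrite (pid_mx_rid _ (subnK le_mn)) mulmx0.
Qed.

Lemma Q_left_invertible : exists X, X *m Q = 1%:M.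
Proof.
case: UFQ => _ [Q' [_ Q'Q]] _; exists (row_botF *m Q').
by rewrite -mulmxA (mulmxA Q') Q'Q mul1mx (rid_mx_rid _ (subnK le_mn)).
Qed.

Lemma constructed_left_inverse (Pt : 'M_n) (W : 'M_m) :
  hyper_regular_decomp Q Pt W -> W *m row_top *m Pt *m Q = 1%:M.
Proof.
move=> [_ [W' [WW' _]]]; rewrite (minn_idPr le_mn) => EPQ.
have PQ : Pt *m Q = col_top *m W' by rewrite -EPQ -(mulmxA _ W) WW' mulmx1.
by rewrite -mulmxA PQ mulmxA -(mulmxA W) (pid_mx_pid _ (subnKC le_mn)) mulmx1.
Qed.

Variables (P : 'M[E]_(m, n)) (c : Kd).
Hypothesis PQ : P *m Q = 1%:M.
(** As a left inverse of [B], [D] recovers the input: u = D A x. [S] is the defining operator that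
    gives u from y. *)
Let D := N *m row_top *m M.
Let S := D *m A *m Q.

(* Membership in the left E-module generated by F amounts to vanishing on Q. *)
Lemma Q_annihilator r (Z : 'M_(r, n)) : Z *m Q = 0 -> Z *m Qt *m col_topF *m U *m F = Z.
Proof.
case: UFQ => _ [Q' [QQ' _]]; rewrite (minn_idPl (leq_subr m n)) -/F => EF ZQ.
have UF : U *m F = row_topF *m Q' by rewrite -EF -(mulmxA _ Qt) QQ' mulmx1.
rewrite -mulmxA UF mulmxA -(mulmxA (Z *m Qt)).
rewrite -[col_topF *m _](addrK (col_botF *m row_botF)) (pid_rid_mx1 _ (subnK le_mn)).
rewrite mulmxBr mulmx1 (mulmxA _ col_botF) -(mulmxA Z Qt) -/Q ZQ mul0mx subr0.
by rewrite -mulmxA QQ' mulmx1.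
Qed.

Lemma D_left_inverse : D *m B = 1%:M.
Proof.
case: MBN => _ [N' [NN' N'N]]; rewrite (minn_idPr le_mn) => EMBN.
have MB : M *m B = col_top *m N' by rewrite -EMBN -(mulmxA _ N) NN' mulmx1.
by rewrite /D -mulmxA MB mulmxA -(mulmxA N) (pid_mx_pid _ (subnKC le_mn)) mulmx1.
Qed.

(** The first block [T *m M' *m col_top] of [T *m M'] equals [T *m B *m N], so only the part
    factoring through [row_bot] survives. *)
Lemma B_annihilator r (T : 'M_(r, n)) : T *m B = 0 -> exists T', T = T' *m row_bot *m M.
Proof.
case: MBN => [[M' [MM' M'M]] _]; rewrite (minn_idPr le_mn) => EMBN TB.
exists (T *m M' *m col_bot).
have z : T *m M' *m col_top = 0.
  by rewrite -EMBN -!mulmxA (mulmxA M') M'M mul1mx (mulmxA T) TB mul0mx.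
rewrite -(mulmxA (T *m M')).
rewrite -[col_bot *m _](addKr (col_top *m row_top)) (pid_rid_mx1 _ (subnKC le_mn)).
by rewrite mulmxDr mulmxN mulmxA z mul0mx oppr0 add0r mulmx1 -mulmxA M'M mulmx1.
Qed.

Let y := P *m @sys_x tau n m + 0 *m @sys_u tau n m.

Lemma def_y : y = row_mx P 0.
Proof. by rewrite /y mul0mx addr0 mul_mx_row mulmx1 mulmx0. Qed.

(** In a relation on y the u-columns give [T *m B = 0], so [Z *m P] is a left multiple of [F];
    multiplying by [Q] on the right gives [Z = 0]. *)
Lemma constructed_independent : independent A B c y.
Proof.
move=> Z _ [T [_]]; rewrite def_y mul_mx_row mulmx0 subr0 mul_mx_row => /eq_row_mx [ZP].
rewrite mulmxN => /(congr1 -%R); rewrite opprK oppr0 => /esym /B_annihilator [T' ET].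
have TA : T *m A = T' *m F by rewrite ET /F !mulmxA.
by rewrite -[Z]mulmx1 -PQ (mulmxA Z) ZP TA -(mulmxA T') F_Q_eq0 mulmx0.
Qed.

Lemma constructed_flat_output : c != 0 ->
  [/\ clears c M, clears c N, clears c U & clears c Qt] -> mx_poly A ->
  [/\ clears c P, clears c Q & clears c S] -> flat_output A B c P 0 Q S.
Proof.
move=> nc [cM cN cU cQt] pA [cP cQ cS].
(* The coefficients writing [1%:M - Q *m P] as a multiple of [F], extended by [row_bot *m M] so as
   to act on [A]. *)
pose T := (1%:M - Q *m P) *m Qt *m col_topF *m U *m row_bot *m M.
have lD : mx_loc c D.
  by do !apply: mx_locM; [exact: mx_loc_clears | exact: mx_loc_pid | exact: mx_loc_clears].
have lA : mx_loc c A by exact: mx_loc_poly.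
have lT : mx_loc c T.
  apply: mx_locM; last exact: mx_loc_clears.
  apply: mx_locM; last exact: mx_loc_rid.
  apply: mx_locM; last exact: mx_loc_clears.
  apply: mx_locM; last exact: mx_loc_pid.
  apply: mx_locM; last exact: mx_loc_clears.
  apply: mx_locD; first exact: mx_loc1.
  by apply: mx_locN; apply: mx_locM; exact: mx_loc_clears.
have TA : T *m A = 1%:M - Q *m P.
  rewrite -[RHS]Q_annihilator; first by rewrite /T /F !mulmxA.
  by rewrite mulmxBl mul1mx -mulmxA PQ mulmx1 subrr.
have TB : T *m B = 0.
  by rewrite /T -!mulmxA (mulmxA row_bot) (decomp_eliminates MBN) !mulmx0.
split.
- by split; [exact: clears_mx_den | exact: mx_den0 | exact: clears_mx_den | exact: clears_mx_den].
- exact: constructed_independent.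
- exists T; split=> //; rewrite -/y def_y !mul_mx_row mulmx0 mulmxN TA TB.
  by rewrite opp_row_mx add_row_mx !oppr0 addr0.
(* u - S y equals D A (x - Q y) - D (A x - B u), because D B = 1. *)
- exists (D *m A *m T - D); split.
    apply: mx_locD; last exact: mx_locN.
    by apply: mx_locM lT; exact: mx_locM.
  have TuA : (D *m A *m T - D) *m A = - (S *m P).
    by rewrite mulmxBl -(mulmxA _ T) TA mulmxBr mulmx1 addrAC subrr sub0r (mulmxA (D *m A)).
  have TuB : (D *m A *m T - D) *m B = - 1%:M.
    by rewrite mulmxBl -(mulmxA _ T) TB mulmx0 D_left_inverse sub0r.
  rewrite -/y def_y !mul_mx_row mulmx0 mulmxN TuA TuB opp_row_mx add_row_mx.
  by rewrite !add0r opprK oppr0 addr0.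
Qed.
End Construction.
End FlatOutputs.

(** * Characterization of flatness and correctness of the construction *)

Theorem theorem2 (tau : R) (tau_gt0 : Rlt R0 tau)
    (n m : nat) (le_mn : (m <= n)%N)
    (A : 'M[Kop tau]_n) (B : 'M[Kop tau]_(n, m))
    (A_poly : mx_poly A) (B_poly : mx_poly B)
    (M : 'M[Kop tau]_n) (N : 'M[Kop tau]_m)
    (MBN : smith_jacobson B M N) :
  let F_of (M' : 'M[Kop tau]_n) : 'M[Kop tau]_(n - m, n) := rid_mx *m M' *m A in
  [/\ pi_flat A B <-> hyper_regular B /\ hyper_regular (F_of M),
      pi_free A B -> hyper_regular (F_of M)
    & hyper_regular B -> hyper_regular (F_of M) ->
      (exists (M : 'M[Kop tau]_n) (N : 'M[Kop tau]_m), hyper_regular_decomp B M N) /\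
      forall (M : 'M[Kop tau]_n) (N : 'M[Kop tau]_m), hyper_regular_decomp B M N ->
      (exists (U : 'M[Kop tau]_(n - m)) (Qt : 'M[Kop tau]_n), hyper_regular_decomp (F_of M) U Qt) /\
      forall (U : 'M[Kop tau]_(n - m)) (Qt : 'M[Kop tau]_n), hyper_regular_decomp (F_of M) U Qt ->
      (exists pi_MN : Kdelta tau, [/\ pi_MN != 0, clears pi_MN M & clears pi_MN N]) /\
      (exists pi_UQ : Kdelta tau, [/\ pi_UQ != 0, clears pi_UQ U & clears pi_UQ Qt]) /\
      forall pi_MN pi_UQ : Kdelta tau,
        [/\ pi_MN != 0, clears pi_MN M & clears pi_MN N] ->
        [/\ pi_UQ != 0, clears pi_UQ U & clears pi_UQ Qt] ->
      (exists pi_bar : Kdelta tau, is_left_lcm pi_bar [:: pi_MN; pi_UQ]) /\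
      forall pi_bar : Kdelta tau, is_left_lcm pi_bar [:: pi_MN; pi_UQ] ->
      let Q : 'M[Kop tau]_(n, m) := Qt *m rid_mx in
      clears pi_bar Q /\
      let R : 'M[Kop tau]_m := N *m (pid_mx m : 'M_(m, n)) *m M *m A *m Q in
      (exists pi_R : Kdelta tau, pi_R != 0 /\ clears pi_R R) /\
      forall pi_R : Kdelta tau, pi_R != 0 -> clears pi_R R ->
      (exists (Pt : 'M[Kop tau]_n) (W : 'M[Kop tau]_m), hyper_regular_decomp Q Pt W) /\
      forall (Pt : 'M[Kop tau]_n) (W : 'M[Kop tau]_m), hyper_regular_decomp Q Pt W ->
      let P : 'M[Kop tau]_(m, n) := W *m (pid_mx m : 'M_(m, n)) *m Pt in
      (exists pi_P : Kdelta tau, pi_P != 0 /\ clears pi_P P) /\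
      forall pi_P : Kdelta tau, pi_P != 0 -> clears pi_P P ->
      (exists pi : Kdelta tau, is_left_lcm pi [:: pi_bar; pi_P; pi_R]) /\
      forall pi : Kdelta tau, is_left_lcm pi [:: pi_bar; pi_P; pi_R] ->
        pi != 0 /\ flat_output A B pi P 0 Q R ].
Proof.
move=> F_of.
have hr_left p q (S : 'M[Kop tau]_(p, q)) le :=
  @hyper_regularP_left _ _ (@Kop_division tau) (@Kop_domain tau) p q S le.
have hr_right p q (S : 'M[Kop tau]_(p, q)) le :=
  @hyper_regularP_right _ _ (@Kop_division tau) (@Kop_domain tau) p q S le.
have [uM _ _] := MBN; have MB := smith_jacobson_eliminates le_mn MBN.
have lcm_neq0 (c : Kdelta tau) s : is_left_lcm c s -> (forall a, a \in s -> a != 0) -> c != 0.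
  exact: (left_lcm_neq0 (Kdelta_left_ore tau)).
have free_F : pi_free A B -> hyper_regular (F_of M).
  move=> /pi_free_right_invertible rAB; apply/hr_right; first exact: leq_subr.
  exact: (eliminated_right_invertible le_mn uM MB rAB).
(* Sufficiency in the equivalence follows from the construction, which is therefore proved first. *)
have share (P1 P2 P3 : Prop) : P2 -> P3 -> (P3 -> P1) -> [/\ P1, P2 & P3].
  by move=> h2 h3 h1; split=> //; exact: h1.
apply: share; first exact: free_F.
- move=> hB hF; split; first by have [M0 [N0 d0]] := hB; exists M0, N0.
  move=> M0 N0 d0.
  (* Hyper-regularity is given for the [F] of the original [M]; it passes to [M0] through right
     invertibility of [row_mx A (- B)]. *)
  have hF0 : hyper_regular (F_of M0).
    apply/hr_right; first exact: leq_subr.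
    have [u0 _ _] := d0; apply: (eliminated_right_invertible le_mn u0 (decomp_eliminates le_mn d0) _).
    apply: (system_right_invertible (@Kop_division tau) (@Kop_domain tau) le_mn uM MB).
    + exact/hr_left.
    + by apply/hr_right; first exact: leq_subr.
  split=> // U Qt dUQ; split; first exact: clears2_exists.
  split; first exact: clears2_exists.
  move=> pMN pUQ [nMN cM cN] [nUQ cU cQt]; split; first exact: Kdelta_lcm_exists.
  move=> pbar lbar Q.
  have mMN : left_multiple pMN pbar by apply: lbar.1; rewrite !inE eqxx.
  have mUQ : left_multiple pUQ pbar by apply: lbar.1; rewrite !inE eqxx orbT.
  have nbar : pbar != 0 by apply: (lcm_neq0 _ _ lbar) => a; rewrite !inE => /orP [] /eqP ->.
  have cQ : clears pbar Q by apply: clears_mul_rid; exact: clears_multiple cQt.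
  split=> // S; split; first by have [c nc cS] := clears_exists S; exists c.
  move=> pS nS cS; split.
    by apply/hr_left => //; exact: (Q_left_invertible le_mn dUQ).
  move=> Pt W dPW P; split; first by have [c nc cP] := clears_exists P; exists c.
  move=> pP nP cP; split; first exact: Kdelta_lcm_exists.
  move=> c lc.
  have mbar : left_multiple pbar c by apply: lc.1; rewrite !inE eqxx.
  have mP : left_multiple pP c by apply: lc.1; rewrite !inE eqxx orbT.
  have mS : left_multiple pS c by apply: lc.1; rewrite !inE eqxx !orbT.
  have nc : c != 0 by apply: (lcm_neq0 _ _ lc) => a; rewrite !inE => /or3P [] /eqP ->.
  split=> //; have PQ := constructed_left_inverse le_mn dPW.
  have [m1 m2] := (left_multiple_trans mMN mbar, left_multiple_trans mUQ mbar).
  apply: (constructed_flat_output le_mn d0 dUQ PQ nc _ A_poly _).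
  + by split; [exact: clears_multiple cM | exact: clears_multiple cN
      | exact: clears_multiple cU | exact: clears_multiple cQt].
  + by split; [exact: clears_multiple cP | exact: clears_multiple cQ | exact: clears_multiple cS].
- move=> construction; split=> [flat | [hB hF]].
  split; first by apply/hr_left => //; exact: (pi_flat_left_invertible flat).
  apply: free_F; have [c [P [Q [S [nc flat']]]]] := flat.
  by exists c, P, 0, Q, S.
(* Run the construction, choosing a witness at each stage. *)
have [[M0 [N0 dMN]] /(_ M0 N0 dMN)] := construction hB hF.
case=> [[U [Qt dUQ]] /(_ U Qt dUQ)] [[pMN dpMN] [[pUQ dpUQ]]].
move/(_ pMN pUQ dpMN dpUQ) => [[pbar lbar] /(_ pbar lbar)] [_ [[pS [nS cS]]]].
move/(_ pS nS cS) => [[Pt [W dPW]] /(_ Pt W dPW)] [[pP [nP cP]]].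
move/(_ pP nP cP) => [[c lc] /(_ c lc)] [nc flat].
by do 4!eexists; split; [exact: nc | exact: flat].
Qed.
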